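(* Let $\mathcal{P}$ be a distribution on the sample space $\mathbb{R}^{d+1}\times\{0,1,\dots,k\}$ and let $s_0,\dots,s_N$ be i.i.d. samples from $\mathcal{P}$. Let $\Theta$ be a parameter set and $l(\cdot,\cdot)\in[0,1]$ a loss function that is Lipschitz in the sample with constant $L_{\rm Lip}$, i.e. $|l(s,\theta)-l(s',\theta)|\le L_{\rm Lip}\|s-s'\|$ for all samples $s,s'$ and all $\theta\in\Theta$, where $\|\cdot\|$ is the Euclidean norm. Let $\mathcal{D}$ be a distribution with support $[0,1)$, $e=\mathbb{E}[\mathcal{D}]$, and for a sample $s$ let $s_\lambda$ denote its RIM augmentation (defined in the context). Define $\theta_*=\arg\min_\theta\mathbb{E}_{s\sim\mathcal{P}}[l(s,\theta)]$, $l_{\rm aug}(s,\theta)=\mathbb{E}_{\lambda\sim\mathcal{D}}[l(s_\lambda,\theta)]$, $\hat\theta_{\rm aug}=\arg\min_\theta\frac{1}{N+1}\sum_{i=0}^N l_{\rm aug}(s_i,\theta)$, and for a function class $h\circ\Theta$ the Rademacher complexity $\mathcal{R}_N(h\circ\Theta)=\mathbb{E}_{\epsilon}\big[\sup_{\theta\in\Theta}\big|\frac{1}{N+1}\sum_{i=0}^N\epsilon_i h(s_i,\theta)\big|\big]$ with $\epsilon_i$ i.i.d. uniform on $\{-1,1\}$. Then for every $\delta\in(0,1)$, with probability at least $1-\delta$ over the samples $\{s_i\}_{i\in[0:N]}$, $$\mathbb{E}_{s\sim\mathcal{P}}[l(s,\hat\theta_{\rm aug})]-\mathbb{E}_{s\sim\mathcal{P}}[l(s,\theta_*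 )]<2\mathcal{R}_N(l_{\rm aug}\circ\Theta)+\sqrt{\frac{2\log(2/\delta)}{N+1}}+2L_{\rm Lip}\,\mathbb{E}_{s\sim\mathcal{P}}\mathbb{E}_{\lambda\sim\mathcal{D}}[\|s_\lambda-s\|].$$ Moreover, $$\mathcal{R}_N(l_{\rm aug}\circ\Theta)\le\mathcal{R}_N(l\circ\Theta)+\max_{i\in\{0,\dots,N\}}L_{\rm Lip}\,\mathbb{E}_{\lambda\sim\mathcal{D}}[\|s_{i,\lambda}-s_i\|],$$ and for each $i$, $\mathbb{E}_{\lambda\sim\mathcal{D}}[\|s_{i,\lambda}-s_i\|]\le 2m_i d e$, where $m_i$ is the maximum absolute value of the $d+1$ features of $s_i$.
   Context: RIM augmentation: for a sample $s=(x_0,x_1,\dots,x_d,y)$ with features $x_j\in\mathbb{R}$ and label $y$, and $\lambda=(\lambda_1,\dots,\lambda_d)$ with components drawn independently from $\mathcal{D}$ (written $\lambda\sim\mathcal{D}$), set $x_{0,\lambda_0}=x_0$, $x_{j,\lambda_j}=(1-\lambda_j)x_j+\lambda_j x_{j-1,\lambda_{j-1}}$ for $j\ge1$, and $s_\lambda=(x_{0,\lambda_0},x_{1,\lambda_1},\dots,x_{d,\lambda_d},y)$; $s_{i,\lambda}$ denotes the augmentation of $s_i$. Samples are viewed as vectors (label included as a coordinate) so that $\|s-s_\lambda\|$ is the Euclidean norm of the feature difference. *)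

(* Defs.v *)
From HB Require Import structures.
From mathcomp Require Import all_boot all_order all_algebra.
From mathcomp Require Import all_classical all_reals all_analysis.

Set Implicit Arguments.
Unset Strict Implicit.
Unset Printing Implicit Defensive.
Import Order.TTheory GRing.Theory Num.Theory.
Import numFieldNormedType.Exports.
Local Open Scope classical_set_scope.
Local Open Scope ring_scope.

Definition sample (R : realType) (d k : nat) : Type := ('rV[R]_d.+1 * 'I_k.+1)%type.
HB.instance Definition _ (R : realType) (d k : nat) :=
  Choice.on (sample R d k).
HB.instance Definition _ (R : realType) (d k : nat) :=
  isPointed.Build (sample R d k) (0, ord0).

(* Generators of the (Borel = product) sigma-algebra on the sample space:
   preimages of Borel sets under the feature coordinates, and label fibres. *)
Definition sample_gen (R : realType) (d k : nat) : set (set (sample R d k)) :=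
  [set A | (exists (j : 'I_d.+1) (B : set R), measurable B /\
              A = (fun s : sample R d k => s.1 ord0 j) @^-1` B)
        \/ (exists y : 'I_k.+1, A = [set s : sample R d k | s.2 = y])].

Definition sampleT (R : realType) (d k : nat)
  : measurableType (sigma_display (@sample_gen R d k)) :=
  g_sigma_algebraType (@sample_gen R d k).

Definition sdist (R : realType) (d k : nat) (s s' : sample R d k) : R :=
  Num.sqrt (\sum_(j < d.+1) (s.1 ord0 j - s'.1 ord0 j) ^+ 2
            + ((nat_of_ord s.2)%:R - (nat_of_ord s'.2)%:R) ^+ 2).

(* RIM recursion: with x n = x_n and lam n = lambda_{n+1},
   rim_rec x lam 0 = x_0 and
   rim_rec x lam (j+1) = (1 - lambda_{j+1}) x_{j+1} + lambda_{j+1} rim_rec x lam j. *)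
Fixpoint rim_rec (R : realType) (x : nat -> R) (lam : nat -> R) (j : nat) : R :=
  match j with
  | 0 => x 0
  | j'.+1 => (1 - lam j') * x j'.+1 + lam j' * rim_rec x lam j'
  end.

(* RIM augmentation s_lambda of s, for lambda = (lambda_1,...,lambda_d)
   given as lam : 'I_d -> R with lam i = lambda_{i+1}. The label is unchanged. *)
Definition rim_aug (R : realType) (d k : nat) (s : sample R d k) (lam : 'I_d -> R)
  : sample R d k :=
  (\row_(j < d.+1)
     rim_rec (fun n => odflt 0 (omap (s.1 ord0) (insub n)))
             (fun n => odflt 0 (omap lam (insub n))) (nat_of_ord j),
   s.2).

Definition mutually_independent (R : realType) (dO : measure_display)
  (O : measurableType dO) (dT : measure_display) (T : measurableType dT)
  (Pr : probability O R) (n : nat) (X : 'I_n -> O -> T) : Prop :=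
  forall B : 'I_n -> set T, (forall i, measurable (B i)) ->
    Pr (\bigcap_(i in [set: 'I_n]) (X i @^-1` B i)) =
    (\prod_(i < n) Pr (X i @^-1` B i))%E.

Definition has_law (R : realType) (dO : measure_display)
  (O : measurableType dO) (dT : measure_display) (T : measurableType dT)
  (Pr : probability O R) (X : O -> T) (mu : probability T R) : Prop :=
  measurable_fun setT X /\
  forall B : set T, measurable B -> Pr (X @^-1` B) = mu B.

Definition rademacher (R : realType) (S Theta : Type) (N : nat)
  (h : S -> Theta -> R) (xs : 'I_N.+1 -> S) : R :=
  (2 ^+ N.+1)^-1 *
  \sum_(eps : {ffun 'I_N.+1 -> bool})
     sup [set r | exists th : Theta,
            r = `| (N.+1%:R)^-1 *
                   \sum_(i < N.+1) ((-1) ^+ eps i * h (xs i) th) |].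

Definition pop_risk (R : realType) (d k : nat) (Theta : Type)
  (P : probability (sampleT R d k) R) (l : sample R d k -> Theta -> R)
  (th : Theta) : R :=
  Rintegral P setT (fun s : sampleT R d k => l s th).

Definition l_aug (R : realType) (d k : nat) (Theta : Type)
  (dL : measure_display) (OL : measurableType dL) (PL : probability OL R)
  (Lam : 'I_d -> OL -> R) (l : sample R d k -> Theta -> R)
  (s : sample R d k) (th : Theta) : R :=
  Rintegral PL setT (fun w => l (rim_aug s (fun j => Lam j w)) th).

Definition aug_dev (R : realType) (d k : nat)
  (dL : measure_display) (OL : measurableType dL) (PL : probability OL R)
  (Lam : 'I_d -> OL -> R) (s : sample R d k) : R :=
  Rintegral PL setT (fun w => sdist (rim_aug s (fun j => Lam j w)) s).

(* E_{s ~ P} E_{lambda ~ D}[ || s_lambda - s || ], as an extended real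
   (it may be +oo when the features are not integrable). *)
Definition pop_aug_dev (R : realType) (d k : nat)
  (P : probability (sampleT R d k) R)
  (dL : measure_display) (OL : measurableType dL) (PL : probability OL R)
  (Lam : 'I_d -> OL -> R) : \bar R :=
  (\int[P]_s
     \int[PL]_w (sdist (rim_aug (s : sample R d k) (fun j => Lam j w)) s)%:E)%E.

Definition emp_risk (R : realType) (S Theta : Type) (N : nat)
  (h : S -> Theta -> R) (xs : 'I_N.+1 -> S) (th : Theta) : R :=
  (N.+1%:R)^-1 * \sum_(i < N.+1) h (xs i) th.

Definition feat_max (R : realType) (d k : nat) (s : sample R d k) : R :=
  \big[Num.max/0]_(j < d.+1) `|s.1 ord0 j|.

(* Main.v *)
(** Write [f] for the augmented losses, [f_0] for that of [th_star], and
    [n = N+1]. Since [l_aug] differs from [l] by at most [Lip * aug_dev], two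
    applications of Lipschitz continuity and the minimality of [th_hat] reduce
    the excess risk to
      V = sup_f (P f - P_n f) + (P_n f_0 - P f_0).
    The Rademacher complexity in the bound is the empirical one, and
    McDiarmid's inequality for [V - 2 R_n] would lose a constant. Instead, let
    [I] be the uniform random set of indices with sign -1, [J] its complement,
    and [f_I] a near-maximizer of [|J| P f - sum_I f(s_i)], which depends on
    [(s_i)_(i in I)] only. Using [f_I] as a competitor in [R_n] and convexity of
    the supremum gives, pointwise,
      n V <= 2 n R_n + E_I [2 sum_I (f_0(s_i) - P f_0) + 2 sum_J (P f_I - f_I(s_j))].
    For fixed [I], conditionally on [(s_i)_(i in I)], the last sum consists of
    independent centered terms of range 2, so Jensen's inequality over [I] and
    Hoeffding's lemma bound its moment generating function at [lam] by
    [exp(n lam^2 / 2)]; Chernoff's bound then gives the constant of the theorem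
    with failure probability [delta / 2].
    Suprema over [Theta] need not be measurable, so all of this is done on a
    finite quantization of the sample space, on which [l_aug] is uniformly close
    to its quantized version up to a cell of small probability; the factor 2 left
    in the failure probability absorbs the quantization error. *)

Require Import Defs.
From HB Require Import structures.
From mathcomp Require Import all_boot all_order all_algebra.
From mathcomp Require Import all_classical all_reals all_analysis.
From mathcomp Require Import measurable_realfun.
From mathcomp Require Import ring lra.
Import Order.TTheory GRing.Theory Num.Theory.
Import numFieldNormedType.Exports.
Local Open Scope classical_set_scope.
Local Open Scope ring_scope.

Set Implicit Arguments.
Unset Strict Implicit.
Unset Printing Implicit Defensive.

(** * Hoeffding's lemma *)

(** Turns the sign of a derivative on the half-line into the sign of the function; used first for
    [g'], then for [g]. *)
Lemma mvt_at0 (R : realType) (f df : R -> R) (s : R) :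
  (forall x, is_derive x (1 : R) f (df x)) -> 0 <= s ->
  exists2 c, 0 <= c & f s - f 0 = df c * s.
Proof.
move=> fd s0.
have cf : {within `[0, s], continuous f}.
  by apply: derivable_within_continuous => x _; have [] := fd x.
have [c] := MVT_segment s0 (fun x _ => fd x) cf.
by rewrite in_itv /= => /andP[c0 _]; rewrite subr0; exists c.
Qed.

(* The cumulant [ln (1 - m + m e^s) - m s] vanishes to first order at 0 and has
   second derivative [u (1 - u) <= 1/4], [u] being the tilted mean. *)
Lemma hoeffding_bernoulli_pos (R : realType) (m s : R) :
  0 <= m <= 1 -> 0 <= s ->
  1 - m + m * expR s <= expR (m * s + s ^+ 2 / 8).
Proof.
move=> /andP[m0 m1] s0.
pose D (x : R) : R := 1 - m + m * expR x.
have Dp x : 0 < D x.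
  rewrite /D; have [->|m_gt0] := eqVneq m 0; first by rewrite subr0 mul0r addr0.
  by apply: ltr_wpDl; [rewrite subr_ge0 | rewrite mulr_gt0 ?expR_gt0// lt0r m_gt0].
have dmE x : is_derive x (1 : R) (fun y => m * expR y) (m * expR x).
  have -> : (fun y => m * expR y) = m \*: (expR : R -> R) by [].
  by apply: is_derive_eq.
have dD x : is_derive x (1 : R) D (m * expR x).
  have -> : D = cst (1 - m) + (fun y => m * expR y) by [].
  by apply: is_derive_eq; rewrite add0r.
pose u x := m * expR x / D x.
have du x : is_derive x (1 : R) u (u x * (1 - u x)).
  have uE : u = (fun y => m * expR y) * (fun y => (D y)^-1) by [].
  rewrite [X in is_derive _ _ X]uE.
  have dV := is_deriveV (lt0r_neq0 (Dp x)) (dD x).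
  apply: is_derive_eq; rewrite /GRing.scale /= /u.
  have := lt0r_neq0 (Dp x) => D0. by field.
pose g' x := m + x / 4 - u x.
have dx x : is_derive x (1 : R) (fun y : R => y / 4) 4^-1.
  have -> : (fun y : R => y / 4) = 4^-1 \*: (@id R).
    by apply/funext => y /=; rewrite mulrC.
  by apply: is_derive_eq; rewrite /GRing.scale /= mulr1.
have dg' x : is_derive x (1 : R) g' (4^-1 - u x * (1 - u x)).
  have g'E : g' = cst m + (fun y : R => y / 4) - u by [].
  rewrite [X in is_derive _ _ X]g'E.
  by apply: is_derive_eq; rewrite add0r.
have g'0 x : 0 <= x -> 0 <= g' x.
  move=> x0; have [c _] := mvt_at0 dg' x0.
  have -> : g' 0 = 0.
    by rewrite /g' /u /D expR0 mulr1 subrK divr1 mul0r addr0 subrr.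
  rewrite subr0 => ->; apply: mulr_ge0 => //.
  have -> : 4^-1 - u c * (1 - u c) = (u c - 2^-1) ^+ 2 by field.
  exact: sqr_ge0.
pose g (x : R) := m * x + x ^+ 2 / 8 - ln (D x).
have dg x : is_derive x (1 : R) g (g' x).
  have dl : is_derive x (1 : R) (fun y => ln (D y)) ((D x)^-1 * (m * expR x)).
    exact: (is_derive1_comp (is_derive1_ln (Dp x)) (dD x)).
  have -> : g = m \*: (@id R) + 8^-1 \*: (fun y : R => y ^+ 2) - (fun y => ln (D y)).
    by apply/funext => y; rewrite /g !fctE /= /GRing.scale /= (mulrC _ 8^-1).
  apply: is_derive_eq; rewrite /g' /u /GRing.scale /= !mulr1.
  by have D0 := lt0r_neq0 (Dp x); field.
have [c c0] := mvt_at0 dg s0.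
have -> : g 0 = 0.
  by rewrite /g /D expR0 mulr1 subrK ln1 mulr0 expr0n /= mul0r addr0 subr0.
rewrite subr0 => gs.
have : 0 <= g s by rewrite gs mulr_ge0 ?g'0.
by rewrite /g subr_ge0 -ler_expR lnK // posrE.
Qed.

(** Exchanging [m] with [1 - m] and [s] with [- s] multiplies both sides by [expR (- s)], so
    negative [s] reduces to positive [s]. *)
Lemma hoeffding_bernoulli (R : realType) (m s : R) : 0 <= m <= 1 ->
  1 - m + m * expR s <= expR (m * s + s ^+ 2 / 8).
Proof.
move=> m01; have [s0|s0] := leP 0 s; first exact: hoeffding_bernoulli_pos.
have m01' : 0 <= 1 - m <= 1 by lra.
have Ns0 : 0 <= - s by lra.
have := hoeffding_bernoulli_pos m01' Ns0.
rewrite -(ler_pM2l (expR_gt0 s)) mulrDr mulrCA -!expRD subrr expR0.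
have -> : s + ((1 - m) * - s + (- s) ^+ 2 / 8) = m * s + s ^+ 2 / 8 by field.
by apply: le_trans; rewrite le_eqVlt; apply/orP; left; apply/eqP; ring.
Qed.

(** Convexity of the exponential between 0 and [s]; it reduces a [0,1]-valued variable to a
    Bernoulli variable of the same mean. *)
Lemma expR_le_chord (R : realType) (s x : R) : 0 <= x <= 1 ->
  expR (s * x) <= 1 - x + x * expR s.
Proof.
move=> x01; have := @convex_expR R (Itv01 (proj1 (andP x01)) (proj2 (andP x01))) s 0.
rewrite !convRE /= expR0 !mulr0 addr0 mulr1 mulrC => /le_trans; apply.
by rewrite addrC.
Qed.

(** Jensen's inequality, by summing the tangent-line bound at the mean [m]: the linear terms
    cancel. *)
Lemma expR_uniform_jensen (R : realType) (I : finType) (a : I -> R) :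
  (0 < #|I|)%N ->
  expR (#|I|%:R^-1 * \sum_i a i) <= #|I|%:R^-1 * \sum_i expR (a i).
Proof.
move=> I0; set m := _^-1 * _.
have I0' : (#|I|%:R : R) != 0 by rewrite pnatr_eq0 -lt0n.
have /(ler_sum _) : forall i, predT i -> expR m * (1 + (a i - m)) <= expR (a i).
  move=> i _; have -> : expR (a i) = expR m * expR (a i - m) by rewrite -expRD subrKC.
  by rewrite ler_pM2l ?expR_gt0// expR_ge1Dx.
move=> h; rewrite -(ler_pM2l (_ : 0 < #|I|%:R)) ?ltr0n// mulVKf//.
apply: le_trans (h _); rewrite -mulr_sumr big_split /= sumrB !sumr_const.
rewrite -[m *+ _]mulr_natl -[1 *+ _]mulr_natl mulr1 {2}/m mulVKf//.
by rewrite subrr addr0 mulrC.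
Qed.

(** * Samples from a finite set *)

Section finite_sample.
Variables (R : realType) (K : finType) (p : K -> R) (n : nat).
Hypotheses (p0 : forall x, 0 <= p x) (p1 : \sum_x p x = 1).
Implicit Types (c : {ffun 'I_n -> K}) (e : {ffun 'I_n -> bool}).

Definition wt c : R := \prod_i p (c i).
Definition fmean (g : K -> R) : R := \sum_x p x * g x.

Lemma wt_ge0 c : 0 <= wt c.
Proof. by apply: prodr_ge0. Qed.

(** Independence of the coordinates under the product law, obtained by distributing the product over
    the sums. *)
Lemma sum_wt_prod (u : 'I_n -> K -> R) :
  \sum_c wt c * \prod_i u i (c i) = \prod_i \sum_x p x * u i x.
Proof.
rewrite bigA_distr_bigA /=; apply: eq_bigr => c _.
by rewrite /wt -big_split.
Qed.

Lemma sum_wt : \sum_c wt c = 1.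
Proof.
transitivity (\sum_c wt c * \prod_(i < n) 1).
  by apply: eq_bigr => c _; rewrite big1 ?mulr1.
rewrite (sum_wt_prod (fun _ _ => 1)) big1 // => i _.
by under eq_bigr do rewrite mulr1.
Qed.

Definition mix e c c' : {ffun 'I_n -> K} := [ffun i => if e i then c i else c' i].

(* Swapping the coordinates outside [e] of two independent samples preserves
   their joint law: this decouples the two blocks of a single sample. *)
Lemma sum_mix e (g : {ffun 'I_n -> K} -> R) :
  \sum_c wt c * g c = \sum_c \sum_c' wt c * wt c' * g (mix e c c').
Proof.
rewrite pair_big /=.
pose phi (q : {ffun 'I_n -> K} * {ffun 'I_n -> K}) := (mix e q.1 q.2, mix e q.2 q.1).
have phiK : involutive phi.
  by move=> [c c']; congr pair; apply/ffunP => i; rewrite !ffunE /=; case: (e i).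
rewrite (reindex_inj (inv_inj phiK)) /=.
transitivity (\sum_(q : {ffun 'I_n -> K} * {ffun 'I_n -> K}) wt q.1 * wt q.2 * g q.1).
  rewrite -(pair_big predT predT (fun c c' => wt c * wt c' * g c)) /=.
  apply: eq_bigr => c _; rewrite -mulr_suml -mulr_sumr.
  by rewrite sum_wt mulr1.
apply: eq_bigr => -[c c'] _ /=; congr (_ * g _).
  rewrite /wt -!big_split /=; apply: eq_bigr => i _; rewrite !ffunE.
  by case: (e i); rewrite // mulrC.
by apply/ffunP => i; rewrite !ffunE; case: (e i).
Qed.

Lemma hoeffding_fmean (f : K -> R) (s : R) : (forall x, 0 <= f x <= 1) ->
  \sum_x p x * expR (s * (f x - fmean f)) <= expR (s ^+ 2 / 8).
Proof.
move=> f01.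
have m01 : 0 <= fmean f <= 1.
  apply/andP; split; first by apply: sumr_ge0 => x _; rewrite mulr_ge0 //; case/andP: (f01 x).
  rewrite -p1; apply: ler_sum => x _; rewrite ler_piMr //.
  by case/andP: (f01 x).
rewrite -(ler_pM2l (expR_gt0 (fmean f * s))) -expRD.
apply: le_trans (hoeffding_bernoulli s m01).
rewrite mulr_sumr.
have -> : 1 - fmean f + fmean f * expR s = \sum_x p x * (1 - f x + f x * expR s).
  under [RHS]eq_bigr do rewrite mulrDr mulrBr mulr1 mulrA.
  by rewrite big_split /= sumrB p1 -mulr_suml.
apply: ler_sum => x _; rewrite mulrCA ler_wpM2l // -expRD.
have -> : fmean f * s + s * (f x - fmean f) = s * f x by ring.
exact: expR_le_chord.
Qed.

Variables (Theta : Type) (F : Theta -> K -> R) (ths : Theta).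
Hypothesis F01 : forall th x, 0 <= F th x <= 1.

Section decoupled.
(** The data-dependent parameter; [th_mix] encodes that [th e c] reads [c] only on the block where
    [e] is true. *)
Variable th : {ffun 'I_n -> bool} -> {ffun 'I_n -> K} -> Theta.
Hypothesis th_mix : forall e c c', th e (mix e c c') = th e c.

(* [e i = true] stands for [i] in [I], i.e. for the sign [(-1) ^+ e i = -1]. *)
Definition split_dev e c : R := \sum_i
  (if e i then F ths (c i) - fmean (F ths)
   else fmean (F (th e c)) - F (th e c) (c i)).

(** By [sum_mix] the coordinates outside the block become a fresh sample [c'], for which [th e c] is
    fixed. The sum over [c'] then factors, and after it the sum over [c]. Each coordinate
    contributes Hoeffding's bound at [2 * lam] up to sign, and
    [(2 * lam) ^+ 2 / 8 = lam ^+ 2 / 2]. *)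
Lemma split_dev_mgf e (lam : R) :
  \sum_c wt c * expR (lam * (2 * split_dev e c)) <= expR (n%:R * (lam ^+ 2 / 2)).
Proof.
pose E := expR (lam ^+ 2 / 2).
pose A x := expR ((2 * lam) * (F ths x - fmean (F ths))).
pose B t x := expR (- (2 * lam) * (F t x - fmean (F t))).
have mgfA : \sum_x p x * A x <= E.
  apply: le_trans (hoeffding_fmean _ (F01 ths)) _.
  by rewrite ler_expR le_eqVlt; apply/orP; left; apply/eqP; field.
have mgfB t : \sum_x p x * B t x <= E.
  apply: le_trans (hoeffding_fmean _ (F01 t)) _.
  by rewrite ler_expR le_eqVlt; apply/orP; left; apply/eqP; field.
rewrite (sum_mix e) /=.
pose EJ := \prod_(i < n) (if e i then 1 else E).
have -> : expR (n%:R * (lam ^+ 2 / 2)) = (\prod_(i < n) (if e i then E else 1)) * EJ.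
  rewrite -big_split /= expRM_natl.
  rewrite -/E -[in LHS](card_ord n) -prodr_const; apply: eq_bigr => i _.
  by case: (e i); rewrite ?mul1r ?mulr1.
apply: (@le_trans _ _ (\sum_c wt c * (\prod_i (if e i then A (c i) else 1)) * EJ)).
  apply: ler_sum => c _.
  have -> : \sum_c' wt c * wt c' * expR (lam * (2 * split_dev e (mix e c c'))) =
     wt c * (\prod_i (if e i then A (c i) else 1)) *
     \sum_c' wt c' * \prod_i (if e i then 1 else B (th e c) (c' i)).
    rewrite mulr_sumr; apply: eq_bigr => c' _.
    rewrite -!mulrA; congr (_ * _); rewrite [RHS]mulrCA; congr (_ * _).
    rewrite /split_dev th_mix mulrA mulr_sumr expR_sum -big_split /=.
    apply: eq_bigr => i _; rewrite !ffunE; case: (e i); rewrite ?mulr1 ?mul1r /A /B.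
      by rewrite (mulrC lam).
    by congr expR; ring.
  rewrite ler_wpM2l //.
    apply: mulr_ge0; first exact: wt_ge0.
    by apply: prodr_ge0 => i _; case: (e i); rewrite ?expR_ge0.
  rewrite (sum_wt_prod (fun i x => if e i then 1 else B (th e c) x)).
  apply: ler_prod => i _; case: (e i).
    by under eq_bigr do rewrite mulr1; rewrite p1 ler01 lexx.
  by rewrite mgfB sumr_ge0 // => x _; rewrite mulr_ge0 // expR_ge0.
rewrite -mulr_suml ler_wpM2r //.
  by apply: prodr_ge0 => i _; case: (e i); rewrite ?expR_ge0.
rewrite (sum_wt_prod (fun i x => if e i then A x else 1)).
apply: ler_prod => i _; case: (e i).
  by rewrite mgfA sumr_ge0 // => x _; rewrite mulr_ge0 // expR_ge0.
by under eq_bigr do rewrite mulr1; rewrite p1 ler01 lexx.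
Qed.

Definition mean_split_dev c : R := (2 ^+ n)^-1 * \sum_e (2 * split_dev e c).

(** Chernoff's bound with parameter [t], the minimizer of [lam ^+ 2 / 2 - lam * t] in [lam]. *)
Lemma mean_split_dev_tail (t : R) : 0 <= t ->
  \sum_(c | n%:R * t <= mean_split_dev c) wt c <= expR (- (n%:R * (t ^+ 2 / 2))).
Proof.
move=> t0.
apply: (@le_trans _ _ (\sum_c wt c * expR (t * (mean_split_dev c - n%:R * t)))).
  rewrite [leRHS](bigID (fun c => n%:R * t <= mean_split_dev c)) /= -[leLHS]addr0.
  apply: lerD; last by apply: sumr_ge0 => c _; rewrite mulr_ge0 ?wt_ge0 ?expR_ge0.
  apply: ler_sum => c tc; rewrite ler_peMr ?wt_ge0// -[leLHS]expR0 ler_expR.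
  by rewrite mulr_ge0 // subr_ge0.
have -> : - (n%:R * (t ^+ 2 / 2)) = n%:R * (t ^+ 2 / 2) + - (n%:R * t ^+ 2) :> R by field.
rewrite expRD.
under eq_bigr do rewrite mulrBr expRD mulrA.
rewrite -mulr_suml (_ : t * (n%:R * t) = n%:R * t ^+ 2); last by ring.
rewrite ler_pM2r ?expR_gt0//.
have cardE : #|{: {ffun 'I_n -> bool}}| = (2 ^ n)%N by rewrite card_ffun card_bool card_ord.
(* Jensen's inequality moves the average over [e] out of the exponential, so the dependence between
   different splits is harmless. *)
apply: (@le_trans _ _ (\sum_c wt c *
   ((2 ^+ n)^-1 * \sum_e expR (t * (2 * split_dev e c))))).
  apply: ler_sum => c _; rewrite ler_wpM2l ?wt_ge0//.
  rewrite /mean_split_dev mulrCA mulr_sumr.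
  have := @expR_uniform_jensen R _ (fun e => t * (2 * split_dev e c)).
  by rewrite cardE natrX expn_gt0 /=; apply.
under eq_bigr do rewrite mulrCA mulr_sumr.
rewrite -mulr_sumr exchange_big /= -(ler_pM2l (_ : 0 < 2 ^+ n)) ?exprn_gt0//.
rewrite mulVKf ?expf_neq0//.
apply: le_trans (ler_sum _ (fun e _ => split_dev_mgf e t)) _.
by rewrite sumr_const cardE -[leLHS]mulr_natl natrX.
Qed.

End decoupled.
End finite_sample.

(** * Sign averages, near-maximizers and the empirical Rademacher complexity *)

Lemma norm_mean_le (R : realType) (N : nat) (a : 'I_N.+1 -> R) (M : R) :
  (forall i, `|a i| <= M) -> `|(N.+1%:R)^-1 * \sum_(i < N.+1) a i| <= M.
Proof.
move=> aM; rewrite normrM gtr0_norm ?invr_gt0// ler_pdivrMl//.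
apply: le_trans (ler_norm_sum _ _ _) _.
apply: (@le_trans _ _ (\sum_(i < N.+1) M)); first exact: ler_sum.
by rewrite sumr_const card_ord -[leLHS]mulr_natl.
Qed.

(** Flipping every sign is a bijection that exchanges [a] and [b], so twice the sum is a sum of
    constants. *)
Lemma sum_ffun_bool_if (R : realType) (n : nat) (i : 'I_n) (a b : R) :
  (2 ^+ n)^-1 * (\sum_(e : {ffun 'I_n -> bool}) if e i then a else b) = (a + b) / 2.
Proof.
pose flip (e : {ffun 'I_n -> bool}) := [ffun j => ~~ e j].
have flipK : involutive flip by move=> e; apply/ffunP => j; rewrite !ffunE negbK.
set S := (\sum_e _).
have : S + S = 2 ^+ n * (a + b).
  rewrite {2}/S (reindex_inj (inv_inj flipK)) /= -big_split /=.
  rewrite (eq_bigr (fun=> a + b)).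
    by rewrite sumr_const card_ffun card_bool card_ord -natrX mulr_natl.
  by move=> e _; rewrite ffunE; case: (e i); rewrite //= addrC.
move=> h; have -> : S = 2 ^+ n * ((a + b) / 2) by rewrite mulrA -h; field.
by rewrite mulKf ?expf_neq0.
Qed.

(** The supremum over the parameters need not be attained; an [eps]-maximizer replaces the
    maximizer. *)
Lemma near_argmax (R : realType) (T : Type) (g : T -> R) (M eps : R) (t0 : T) :
  0 < eps -> (forall t, g t <= M) -> exists t, forall t', g t' <= g t + eps.
Proof.
move=> e0 gM.
have hs : has_sup (range g).
  by split; [exists (g t0), t0 | exists M => _ [t _ <-]; exact: gM].
have [_ [t _ <-] ht] := sup_adherent e0 hs.
exists t => t'; rewrite -lerBlDr; apply: ltW; apply: le_lt_trans ht.
by rewrite lerB //; apply: ub_le_sup; [case: hs | exists t'].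
Qed.

Section rademacher_lemmas.
Variables (R : realType) (S Theta : Type) (N : nat).
Variables (h : S -> Theta -> R) (xs : 'I_N.+1 -> S).
Hypothesis h01 : forall s th, 0 <= h s th <= 1.

Lemma rademacher_set_ubound (eps : {ffun 'I_N.+1 -> bool}) :
  has_ubound [set r : R | exists th : Theta,
     r = `| (N.+1%:R)^-1 * \sum_(i < N.+1) ((-1) ^+ eps i * h (xs i) th) |].
Proof.
exists 1 => _ [th ->]; apply: norm_mean_le => i.
by rewrite normrMsign ger0_norm; case/andP: (h01 (xs i) th).
Qed.

(** A parameter chosen as a function of the signs is, for each sign pattern, a competitor in the
    supremum. *)
Lemma rademacher_ge_selection (th : {ffun 'I_N.+1 -> bool} -> Theta) :
  (2 ^+ N.+1)^-1 * (\sum_(e : {ffun 'I_N.+1 -> bool})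
     (N.+1%:R)^-1 * \sum_(i < N.+1) ((-1) ^+ e i * h (xs i) (th e)))
  <= rademacher h xs.
Proof.
rewrite /rademacher ler_wpM2l ?invr_ge0 ?exprn_ge0//.
apply: ler_sum => e _; apply: le_trans (ler_norm _) _.
by apply: ub_le_sup; [exact: rademacher_set_ubound | exists (th e)].
Qed.

End rademacher_lemmas.

(** The two sample spaces may differ: this compares samples with cell representatives as well as
    [l_aug] with [l]. The element [th0] makes the suprema range over nonempty sets. *)
Lemma rademacher_perturb (R : realType) (S S' Theta : Type) (N : nat)
    (h : S -> Theta -> R) (xs : 'I_N.+1 -> S)
    (h' : S' -> Theta -> R) (xs' : 'I_N.+1 -> S') (eta : R) (th0 : Theta) :
  (forall s th, 0 <= h' s th <= 1) ->
  (forall i th, `|h (xs i) th - h' (xs' i) th| <= eta) ->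
  rademacher h xs <= rademacher h' xs' + eta.
Proof.
move=> h01 hh'.
have c0 : 0 < (2 ^+ N.+1 : R) by rewrite exprn_gt0.
rewrite /rademacher -[leLHS](mulKf (lt0r_neq0 c0)) -(ler_pM2l c0).
rewrite mulVKf ?lt0r_neq0// mulrDr !mulVKf ?lt0r_neq0//.
have -> : 2 ^+ N.+1 * eta = \sum_(eps : {ffun 'I_N.+1 -> bool}) eta.
  by rewrite sumr_const card_ffun card_bool card_ord -natrX mulr_natl.
rewrite -big_split /=; apply: ler_sum => e _.
apply: ge_sup; first by eexists; exists th0.
move=> _ [th ->].
rewrite -lerBlDr; apply: le_trans (_ : _ <= _)
  (ub_le_sup (rademacher_set_ubound xs' h01 e) _); last by exists th.
rewrite lerBlDr -lerBlDl; apply: le_trans (lerB_dist _ _) _.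
rewrite -mulrBr -sumrB; apply: norm_mean_le => i.
by rewrite -mulrBr normrMsign.
Qed.

(** * Excess risk over a finite sample space *)

Section finite_excess.
Variables (R : realType) (K : finType) (p : K -> R) (N : nat).
Hypotheses (p0 : forall x, 0 <= p x) (p1 : \sum_x p x = 1).
Variables (Theta : Type) (F : Theta -> K -> R) (ths : Theta).
Hypothesis F01 : forall th x, 0 <= F th x <= 1.

Let mu th := fmean p (F th).

(* The average over [e] of [\sum_i (if e i then - F t (c i) else mu t)] is half of
   [\sum_i (mu t - F t (c i))], and [\sum_i (F ths (c i) - mu ths)] is the average
   of twice its restriction to [e]. *)
Lemma excess_le_split_dev (th : {ffun 'I_N.+1 -> bool} -> {ffun 'I_N.+1 -> K} -> Theta)
    (eps : R) (c : {ffun 'I_N.+1 -> K}) (t : Theta) :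
  (forall (e : {ffun 'I_N.+1 -> bool}) t, \sum_i (if e i then - F t (c i) else mu t) <=
     \sum_i (if e i then - F (th e c) (c i) else mu (th e c)) + eps) ->
  \sum_i (mu t - F t (c i)) + \sum_i (F ths (c i) - mu ths) <=
  2 * (N.+1%:R * rademacher (fun x t => F t x) c)
  + mean_split_dev p F ths th c + 2 * eps.
Proof.
move=> hth.
set n := N.+1; pose A (f : {ffun 'I_n -> bool} -> R) := (2 ^+ n)^-1 * \sum_e f e.
have c0 : 0 < ((2 ^+ n)^-1 : R) by rewrite invr_gt0 exprn_gt0.
have Ale f g : (forall e, f e <= g e) -> A f <= A g.
  by move=> fg; rewrite /A ler_pM2l//; apply: ler_sum => e _; exact: fg.
have AD f g : A (fun e => f e + g e) = A f + A g by rewrite /A big_split mulrDr.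
have AZ k f : A (fun e => k * f e) = k * A f by rewrite /A -mulr_sumr mulrCA.
have Asum (a b : 'I_n -> R) :
    A (fun e => \sum_i if e i then a i else b i) = \sum_i (a i + b i) / 2.
  rewrite /A exchange_big mulr_sumr /=; apply: eq_bigr => i _.
  exact: sum_ffun_bool_if.
have Acst k : A (fun=> k) = k.
  by rewrite /A sumr_const card_ffun card_bool card_ord -[k *+ _]mulr_natl natrX
     mulKf ?expf_neq0.
have := rademacher_ge_selection (h := fun x t => F t x) c (fun x t => F01 t x)
  (fun e => th e c).
rewrite -/(A _) AZ ler_pdivrMl//= => hR.
(* [X] is the objective at the selected parameter, [Y] recenters its terms outside the block so that
   [X + Y] is a signed sum, and [Z] is the deviation of [ths] on the block. *)
pose X (e : {ffun 'I_n -> bool}) := \sum_i (if e i then - F (th e c) (c i) else mu (th e c)).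
pose Y (e : {ffun 'I_n -> bool}) := \sum_i (if e i then 0 else F (th e c) (c i) - mu (th e c)).
pose Z (e : {ffun 'I_n -> bool}) := \sum_i (if e i then F ths (c i) - mu ths else 0).
have XYR : A X + A Y <= n%:R * rademacher (fun x t => F t x) c.
  rewrite -AD; apply: le_trans hR; apply: Ale => e; rewrite -big_split /=.
  apply: ler_sum => i _; case: (e i); first by rewrite addr0 expr1 mulN1r.
  by rewrite subrKC expr0 mul1r.
have XA : \sum_i (mu t - F t (c i)) / 2 <= A X + eps.
  rewrite -[eps]Acst -AD.
  under eq_bigr do rewrite addrC.
  by rewrite -(Asum (fun i => - F t (c i)) (fun=> mu t)); apply: Ale => e; exact: hth.
have ZA : \sum_i (F ths (c i) - mu ths) / 2 = A Z.
  by rewrite Asum; apply: eq_bigr => i _; rewrite addr0.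
have -> : mean_split_dev p F ths th c = 2 * (A Z - A Y).
  rewrite /mean_split_dev -/(A _) AZ -[- A Y]mulN1r -[-1 * A Y]AZ -AD; congr (_ * A _).
  apply/funext => e; rewrite mulN1r -sumrB; apply: eq_bigr => i _.
  by case: (e i); rewrite ?subr0 // sub0r opprB.
move: XA ZA; rewrite -!mulr_suml; lra.
Qed.

Lemma finite_excess (t eps : R) : 0 <= t -> 0 < eps ->
  exists Good : {set {ffun 'I_N.+1 -> K}},
    1 - expR (- (N.+1%:R * (t ^+ 2 / 2))) <= \sum_(c in Good) wt p c /\
    forall c, c \in Good -> forall th,
      \sum_i (mu th - F th (c i)) + \sum_i (F ths (c i) - mu ths) <=
      N.+1%:R * (2 * rademacher (fun x t => F t x) c + t + eps).
Proof.
move=> t0 eps0; set n := N.+1.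
have mu01 th : 0 <= mu th <= 1.
  rewrite /mu /fmean; apply/andP; split.
    by apply: sumr_ge0 => x _; rewrite mulr_ge0 //; case/andP: (F01 th x).
  by rewrite -p1; apply: ler_sum => x _; rewrite ler_piMr //; case/andP: (F01 th x).
(* The selector [tau] acts on objective functions, not on samples: [obj e c] sees [c] only on the
   block, so [th_mix] becomes a congruence. Objectives not bounded by [n] receive the default
   [ths]. *)
have [|tau tauP] := @choice (Theta -> R) Theta (fun g s =>
    (forall th, g th <= n%:R) -> forall th', g th' <= g s + eps / 2).
  move=> g; have [gM|gM] := pselect (forall th, g th <= n%:R).
    by have [||s sP] := @near_argmax _ _ g n%:R (eps / 2) ths; [lra| |exists s].
  by exists ths => /gM.
pose obj (e : {ffun 'I_n -> bool}) (c : {ffun 'I_n -> K}) (th : Theta) :=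
  \sum_i (if e i then - F th (c i) else mu th).
pose th e c := tau (obj e c).
have th_mix e c c' : th e (mix e c c') = th e c.
  congr tau; apply/funext => s; apply: eq_bigr => i _.
  by rewrite ffunE; case: (e i).
pose bad c := n%:R * t <= mean_split_dev p F ths th c.
exists [set c | ~~ bad c]%SET; split.
  rewrite lerBlDr -[leLHS](sum_wt n p1) (bigID bad) /= addrC lerD //.
    by under [leRHS]eq_bigl do rewrite inE.
exact: mean_split_dev_tail.
move=> c; rewrite inE -ltNge => cG s.
have hobj e s' : obj e c s' <= obj e c (th e c) + eps / 2.
  apply: tauP => s''; rewrite /obj.
  rewrite -[n in n%:R](card_ord n) -sumr_const; apply: ler_sum => i _.
  by case: (e i); [have := F01 s'' (c i) | have := mu01 s'']; lra.
apply: le_trans (@excess_le_split_dev th (eps / 2) c s hobj) _.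
have n1 : 1 <= n%:R :> R by rewrite ler1n.
rewrite -/n !mulrDr [n%:R * (2 * _)]mulrCA.
have : eps <= n%:R * eps by rewrite ler_peMl // ltW.
lra.
Qed.

End finite_excess.

(** * From finite to general sample spaces *)

Lemma measure_preimage_fin (R : realType) (d : measure_display) (T : measurableType d)
    (mu : probability T R) (K : finType) (g : T -> K) (Q : {pred K}) :
  (forall c, measurable (g @^-1` [set c])) ->
  measurable (g @^-1` [set` Q]) /\
  mu (g @^-1` [set` Q]) = (\sum_(c | c \in Q) mu (g @^-1` [set c]))%E.
Proof.
move=> mg.
have -> : g @^-1` [set` Q] = \bigcup_(c in [set` Q]) (g @^-1` [set c]).
  apply/seteqP; split => [x xQ|x [c cQ gc]]; last by rewrite /= gc.
  by exists (g x).
have finQ : finite_set [set` Q] by exact: finite_finset.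
split; first by apply: fin_bigcup_measurable => // c _; exact: mg.
rewrite measure_fin_bigcup//; last first.
  apply/trivIsetP => i j _ _ /eqP ij; apply/seteqP; split => x //= -[gi gj].
  by apply: ij; rewrite -gi -gj.
by rewrite (@bigfs _ _ _ _ (index_enum K)) ?index_enum_uniq// => i _;
  rewrite mem_index_enum.
Qed.

Lemma integrable_bounded (R : realType) (d : measure_display) (T : measurableType d)
    (P : probability T R) (f : T -> R) (M : R) :
  measurable_fun setT f -> (forall x, `|f x| <= M) ->
  P.-integrable setT (EFin \o f).
Proof.
move=> mf fM; apply: measurable_bounded_integrable => //.
  by apply: le_lt_trans (probability_le1 _ _) _; rewrite ?ltry.
exists M; split; first exact: num_real.
by move=> x Mx y _; apply: le_trans (fM y) (ltW Mx).
Qed.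

Lemma Rintegral_dist_le (R : realType) (d : measure_display) (T : measurableType d)
    (P : probability T R) (f g h : T -> R) (M : R) :
  measurable_fun setT f -> measurable_fun setT g -> measurable_fun setT h ->
  (forall x, `|f x| <= M) -> (forall x, `|g x| <= M) -> (forall x, `|h x| <= M) ->
  (forall x, `|f x - g x| <= h x) ->
  `|Rintegral P setT f - Rintegral P setT g| <= Rintegral P setT h.
Proof.
move=> mf mg mh fM gM hM fgh.
have i1 := integrable_bounded P mf fM.
have i2 := integrable_bounded P mg gM.
have fgM x : `|f x - g x| <= M by apply: le_trans (hM x); apply: le_trans (ler_norm _).
have i3 : P.-integrable setT (EFin \o (fun x => f x - g x)).
  by apply: (@integrable_bounded _ _ _ _ _ M) => //; exact: measurable_funB.
rewrite -RintegralB//; apply: le_trans (le_normr_Rintegral _ i3) _ => //.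
apply: le_Rintegral => //; last by apply: (@integrable_bounded _ _ _ _ _ M).
apply: (@integrable_bounded _ _ _ _ _ M); last by move=> x /=; rewrite normr_id.
by apply: measurableT_comp => //; exact: measurable_funB.
Qed.

Lemma Rintegral_prob_cst (R : realType) (d : measure_display) (T : measurableType d)
    (P : probability T R) (c : R) : Rintegral P setT (cst c) = c.
Proof.
have P1 : fine (P setT) = 1 by rewrite probability_setT.
by rewrite Rintegral_cst// P1 mulr1.
Qed.

(** [K] carries no sigma-algebra: measurable fibres suffice, since [g \o cell] is a finite
    combination of their indicators. *)
Lemma Rintegral_fin_comp (R : realType) (d : measure_display) (T : measurableType d)
    (P : probability T R) (K : finType) (cell : T -> K) (g : K -> R) :
  (forall c, measurable (cell @^-1` [set c])) ->
  measurable_fun setT (g \o cell) /\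
  Rintegral P setT (g \o cell) =
  \sum_c fine (P (cell @^-1` [set c])) * g c.
Proof.
move=> mcell.
have E : g \o cell = (fun s => \sum_c g c * \1_(cell @^-1` [set c]) s).
  apply/funext => s /=; rewrite (bigD1 (cell s)) //= indicE mem_set// mulr1.
  rewrite big1 ?addr0// => c cs; rewrite indicE memNset ?mulr0//=.
  by move=> sc; rewrite sc eqxx in cs.
have mind c : measurable_fun setT (fun s => g c * \1_(cell @^-1` [set c]) s : R).
  by apply: measurable_funM => //; exact: measurable_indic.
have iind c : P.-integrable setT
    (fun s => (g c * \1_(cell @^-1` [set c]) s)%:E).
  apply: (@integrable_bounded _ _ _ _ _ `|g c|) => // x.
  by rewrite normrM ler_piMr// indicE; case: (_ \in _); rewrite ?normr1 ?normr0.
split; first by rewrite E; apply: measurable_sum.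
rewrite E /Rintegral; under eq_integral do rewrite -sumEFin.
rewrite integral_sum//.
rewrite (eq_bigr (fun c => (fine (P (cell @^-1` [set c])) * g c)%:E)).
  by rewrite sumEFin.
move=> c _; under eq_integral do rewrite EFinM.
rewrite integralZl//; last first.
  apply: (@integrable_bounded _ _ _ _ _ 1); first exact: measurable_indic.
  by move=> x; rewrite indicE; case: (_ \in _); rewrite ?normr1 ?normr0.
by rewrite integral_indic// setIT EFinM fineK ?fin_num_measure// muleC.
Qed.

(** * Uniform deviation by quantization of the sample space *)

Section uniform_deviation.
Variables (R : realType) (dT : measure_display) (T : measurableType dT).
Variables (P : probability T R) (N : nat).
Variables (dO : measure_display) (Omega : measurableType dO) (Pr : probability Omega R).
Variables (X : 'I_N.+1 -> Omega -> T).
Hypotheses (Xlaw : forall i, has_law Pr (X i) P) (Xind : mutually_independent Pr X).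
Variables (Theta : Type) (f : T -> Theta -> R) (ths : Theta).
Hypothesis f01 : forall s th, 0 <= f s th <= 1.
Hypothesis fmeas : forall th, measurable_fun setT (fun s => f s th).

Section quantized.
Variables (K : finType) (cell : T -> K) (rep : K -> T) (trash : K) (eta : R).
Hypothesis mcell : forall c, measurable (cell @^-1` [set c]).
Hypothesis cell_close : forall s, cell s != trash ->
  forall th, `|f s th - f (rep (cell s)) th| <= eta.
Hypothesis trash_small : (P (cell @^-1` [set trash]) <= eta%:E)%E.

Definition cell_mass (c : K) : R := fine (P (cell @^-1` [set c])).

Lemma cell_massE c : P (cell @^-1` [set c]) = (cell_mass c)%:E.
Proof. by rewrite /cell_mass fineK// fin_num_measure. Qed.

Lemma cell_mass_ge0 c : 0 <= cell_mass c.
Proof. by rewrite fine_ge0. Qed.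

Lemma cell_mass_trash : cell_mass trash <= eta.
Proof. by rewrite -lee_fin -cell_massE. Qed.

Lemma sum_cell_mass : \sum_c cell_mass c = 1.
Proof.
have [_] := @measure_preimage_fin _ _ _ P K cell predT mcell.
have -> : cell @^-1` [set` predT] = setT by apply/seteqP; split.
move=> h; have := etrans (esym h) (probability_setT P).
by under eq_bigr do rewrite cell_massE; rewrite sumEFin => -[].
Qed.

(** The integrands differ by at most [eta] outside [trash], and by at most 1 on [trash], whose mass
    is at most [eta]. *)
Lemma cell_risk_close th :
  `|Rintegral P setT (fun s => f s th)
    - fmean cell_mass (fun c => f (rep c) th)| <= 2 * eta.
Proof.
pose g c := f (rep c) th.
have [mg gE] := Rintegral_fin_comp P g mcell.
rewrite -[fmean _ _]/(\sum_c fine (P (cell @^-1` [set c])) * g c) -gE.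
pose b c : R := if c == trash then 1 else eta.
have [mb bE] := Rintegral_fin_comp P b mcell.
have eta0 : 0 <= eta := le_trans (cell_mass_ge0 _) cell_mass_trash.
have f_le x : `|f x th| <= 1 + eta.
  by have /andP[? ?] := f01 x th; rewrite ger0_norm//; lra.
apply: (@le_trans _ _ (Rintegral P setT (b \o cell))).
  apply: (@Rintegral_dist_le _ _ _ _ _ _ _ (1 + eta)) => // x /=; first exact: f_le.
    by rewrite /b; case: ifP => _; rewrite ger0_norm//; lra.
  rewrite /b; case: ifPn => [_|xt]; last exact: cell_close.
  have := f01 x th; have := f01 (rep (cell x)) th.
  by rewrite -/(g _) => ? ?; rewrite ler_norml; lra.
rewrite bE mulr2n mulrDl !mul1r (bigD1 trash)//= {1}/b eqxx mulr1.
rewrite lerD//; first exact: cell_mass_trash.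
rewrite -[leRHS]mul1r -[X in X * _]sum_cell_mass mulr_suml [leRHS](bigD1 trash)//=.
rewrite ler_wpDl ?mulr_ge0 ?cell_mass_ge0//.
by apply: ler_sum => c /negPf ct; rewrite /b ct.
Qed.

Definition cells (w : Omega) : {ffun 'I_N.+1 -> K} := [ffun i => cell (X i w)].

(** Independence applied to preimages of cells: the quantized sample has exactly the product law of
    the finite setting. *)
Lemma cells_law (c : {ffun 'I_N.+1 -> K}) :
  measurable (cells @^-1` [set c]) /\
  Pr (cells @^-1` [set c]) = (wt cell_mass c)%:E.
Proof.
have E : cells @^-1` [set c] =
    \bigcap_(i in [set: 'I_N.+1]) (X i @^-1` (cell @^-1` [set c i])).
  apply/seteqP; split => [w <- i _ /=|w wc]; first by rewrite /cells ffunE.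
  by apply/ffunP => i; rewrite ffunE; exact: wc.
rewrite E; split.
  apply: fin_bigcap_measurable; first exact: finite_finset.
  move=> i _; have [mX _] := Xlaw i.
  by rewrite -[X in measurable X]setTI; exact: mX.
rewrite Xind//.
under eq_bigr => i _ do rewrite (proj2 (Xlaw i)) // cell_massE.
by rewrite prodEFin.
Qed.

(** Bernoulli's inequality [(1 - q) ^+ n >= 1 - n * q], by induction, with [q] the mass of
    [trash]. *)
Lemma no_trash_mass :
  1 - N.+1%:R * eta <=
  \sum_(c in ffun_on [pred x | x != trash]) @wt R K cell_mass N.+1 c.
Proof.
rewrite /wt -(bigA_distr_big [pred x | x != trash] (fun _ x => cell_mass x)) /=.
rewrite prodr_const card_ord.
have -> : \sum_(x | x != trash) cell_mass x = 1 - cell_mass trash.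
  by rewrite -[in RHS]sum_cell_mass [in RHS](bigD1 trash) //= addrAC subrr add0r.
have q0 := cell_mass_ge0 trash; have qe := cell_mass_trash.
have q1 : cell_mass trash <= 1.
  rewrite -[leRHS]sum_cell_mass (bigD1 trash) //= lerDl.
  by apply: sumr_ge0 => x _; exact: cell_mass_ge0.
apply: (@le_trans _ _ (1 - N.+1%:R * cell_mass trash)).
  by rewrite lerD2l lerN2 ler_pM2l.
elim: (N.+1) => [|n IH]; first by rewrite mul0r subr0 expr0.
rewrite exprS -natr1.
have q1' : 0 <= 1 - cell_mass trash by rewrite subr_ge0.
apply: le_trans (ler_wpM2l q1' IH).
have : 0 <= n%:R * cell_mass trash ^+ 2 by rewrite mulr_ge0 // sqr_ge0.
nra.
Qed.

(** The event is the preimage of a set of quantized samples, hence measurable whatever the suprema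
    over [Theta]. The error [8 * eta] collects [2 * eta] for each of two population risks, [eta] for
    each of two empirical risks, and [2 * eta] from twice the Rademacher complexity. *)
Lemma quantized_excess (t eps : R) : 0 <= t -> 0 < eps ->
  exists A : set Omega, measurable A /\
    ((1 - expR (- (N.+1%:R * (t ^+ 2 / 2))) - N.+1%:R * eta)%:E <= Pr A)%E /\
    forall w, A w -> forall th,
      (Rintegral P setT (fun s => f s th) - emp_risk f (fun i => X i w) th)
      + (emp_risk f (fun i => X i w) ths - Rintegral P setT (fun s => f s ths))
      <= 2 * rademacher f (fun i => X i w) + t + eps + 8 * eta.
Proof.
move=> t0 eps0.
have F01 th c : 0 <= f (rep c) th <= 1 by [].
have [Good [GoodM GoodP]] := finite_excess N cell_mass_ge0 sum_cell_mass ths F01 t0 eps0.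
pose Q := [pred c : {ffun 'I_N.+1 -> K} | (c \in Good) && (c \in ffun_on [pred x | x != trash])].
have [mA PA] := @measure_preimage_fin _ _ _ Pr _ cells Q (fun c => proj1 (cells_law c)).
exists (cells @^-1` [set` Q]); split => //; split.
  rewrite PA; under eq_bigr do rewrite (proj2 (cells_law _)).
  rewrite sumEFin lee_fin.
  have := no_trash_mass; rewrite (bigID (mem Good)) /=.
  have : \sum_(c in ffun_on [pred x | x != trash] | c \notin Good) wt cell_mass c
      <= \sum_(c | c \notin Good) wt cell_mass c.
    rewrite [leRHS](bigID (mem (ffun_on [pred x | x != trash]))) /=.
    rewrite (eq_bigl (fun c => (c \notin Good) && (c \in ffun_on [pred x | x != trash])));
      last by move=> c; rewrite andbC.
    by rewrite lerDl; apply: sumr_ge0 => c _; apply: wt_ge0; exact: cell_mass_ge0.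
  have := sum_wt N.+1 sum_cell_mass; rewrite (bigID (mem Good)) /=.
  rewrite (eq_bigl Q (fun c => wt cell_mass c)
    (_ : (fun c => (c \in ffun_on [pred x | x != trash]) && (c \in Good)) =1 Q)).
    by move: GoodM; lra.
  by move=> c; rewrite /= andbC.
move=> w /andP[/GoodP wG /ffun_onP wtrash] th.
have fE i t' : `|f (X i w) t' - f (rep (cells w i)) t'| <= eta.
  by have := wtrash i; rewrite inE ffunE => h; exact: cell_close.
have empE t' : `|emp_risk f (fun i => X i w) t' -
    N.+1%:R^-1 * \sum_i f (rep (cells w i)) t'| <= eta.
  by rewrite /emp_risk -mulrBr -sumrB; apply: norm_mean_le.
have RE : rademacher (fun c th => f (rep c) th) (cells w) <=
    rademacher f (fun i => X i w) + eta.
  by apply: rademacher_perturb => // i t'; rewrite distrC.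
have n0 : 0 < N.+1%:R :> R by rewrite ltr0n.
pose m t' := fmean cell_mass (fun c => f (rep c) t').
pose S t' := N.+1%:R^-1 * \sum_i f (rep (cells w i)) t'.
have mE (x : R) : N.+1%:R^-1 * (x *+ N.+1) = x.
  by rewrite -[x *+ _]mulr_natl mulKf ?lt0r_neq0.
have : m th - S th + (S ths - m ths) <=
    2 * rademacher (fun c th => f (rep c) th) (cells w) + t + eps.
  have := wG th; rewrite -ler_pdivrMl// mulrDr !sumrB !mulrBr !sumr_const card_ord.
  by rewrite !mE.
have := cell_risk_close th; have := cell_risk_close ths.
have := empE th; have := empE ths; rewrite -!/(m _) -!/(S _) !ler_norml.
move: RE.
move: (m th) (m ths) (S th) (S ths) => m1 m2 S1 S2.
move: (rademacher _ (cells w)) (rademacher f _) => r1 r2.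
move: (Rintegral _ _ _) (Rintegral _ _ _) => i1 i2.
move: (emp_risk _ _ _) (emp_risk _ _ _) => e1 e2.
lra.
Qed.

End quantized.

Lemma uniform_deviation (delta : R) :
  (forall eta : R, 0 < eta -> exists (K : finType) (cell : T -> K) (rep : K -> T) (trash : K),
    [/\ forall c, measurable (cell @^-1` [set c]),
        forall s, cell s != trash ->
          forall th, `|f s th - f (rep (cell s)) th| <= eta &
        (P (cell @^-1` [set trash]) <= eta%:E)%E]) ->
  0 < delta < 1 ->
  exists A : set Omega, measurable A /\ ((1 - delta)%:E <= Pr A)%E /\
    forall w, A w -> forall th,
      (Rintegral P setT (fun s => f s th) - emp_risk f (fun i => X i w) th)
      + (emp_risk f (fun i => X i w) ths - Rintegral P setT (fun s => f s ths))
      < 2 * rademacher f (fun i => X i w) + Num.sqrt (2 * ln (2 / delta) / N.+1%:R).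
Proof.
move=> quant /andP[d0 d1]; set n : R := N.+1%:R.
have n0 : 0 < n by rewrite ltr0n.
set t := Num.sqrt _.
(* A value strictly between 1 and [2 / delta]. The tail bound [1 / a] is [3 * delta / 4], which
   leaves [delta / 4] for [trash], and the gap [t - t'] pays for [eps] and [8 * eta]. *)
pose a := 4 / (3 * delta).
have a1 : 1 < a by rewrite /a ltr_pdivlMr ?mulr_gt0//; lra.
have a0 : 0 < a by lra.
have a2 : a < 2 / delta.
  have : 0 < delta^-1 by rewrite invr_gt0.
  by rewrite /a invfM mulrA; set z := delta^-1; lra.
have lna : 0 <= 2 * ln a / n by rewrite divr_ge0 ?(ltW n0)// mulr_ge0// ln_ge0// ltW.
pose t' := Num.sqrt (2 * ln a / n).
have t'0 : 0 <= t' by rewrite sqrtr_ge0.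
have tt' : t' < t.
  have lt : 2 * ln a / n < 2 * ln (2 / delta) / n.
    by rewrite ltr_pM2r ?invr_gt0// ltr_pM2l// ltr_ln ?posrE// divr_gt0.
  by rewrite ltr_sqrt//; apply: le_lt_trans lt.
have gap : 0 < t - t' by rewrite subr_gt0.
pose eta := Num.min ((t - t') / 32) (delta / (4 * n)).
have eta0 : 0 < eta by rewrite /eta lt_min !divr_gt0 ?mulr_gt0.
have eta1 : eta <= (t - t') / 32 by rewrite /eta ge_min lexx.
have eta2 : n * eta <= delta / 4.
  have : eta <= delta / (4 * n) by rewrite /eta ge_min lexx orbT.
  by rewrite -(ler_pM2l n0); congr (_ <= _); field; rewrite lt0r_neq0.
have [K [cell [rep [trash [mc cc ts]]]]] := quant eta eta0.
have eps0 : 0 < (t - t') / 2 by lra.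
have [A [mA [PA HA]]] := quantized_excess mc cc ts t'0 eps0.
exists A; split => //; split; last first.
  by move=> w /HA h th; apply: le_lt_trans (h th) _; lra.
apply: le_trans PA; rewrite lee_fin -/n.
have -> : - (n * (t' ^+ 2 / 2)) = - ln a.
  by rewrite /t' sqr_sqrtr//; field; rewrite lt0r_neq0.
have -> : expR (- ln a) = 3 * delta / 4.
  by rewrite expRN lnK ?posrE// /a; field; rewrite lt0r_neq0.
lra.
Qed.

End uniform_deviation.

(** * Geometry and measurability of the sample space *)

Lemma sum_sqr_le_sqr_sum (R : realType) (I : finType) (a : I -> R) :
  \sum_i a i ^+ 2 <= (\sum_i `|a i|) ^+ 2.
Proof.
rewrite [leRHS]expr2 mulr_sumr; apply: ler_sum => i _.
rewrite -(ger0_norm (sqr_ge0 (a i))) normrX expr2 ler_wpM2r//.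
by rewrite (bigD1 i)//= lerDl; apply: sumr_ge0.
Qed.

(** A triangle inequality with the difference measured in the l1 norm: each [v i] is at most [V] in
    absolute value, which bounds the cross term by [V * H]. *)
Lemma sqrt_sum_sqr_le (R : realType) (I : finType) (u v : I -> R) :
  Num.sqrt (\sum_i u i ^+ 2) <=
  Num.sqrt (\sum_i v i ^+ 2) + \sum_i `|u i - v i|.
Proof.
set V := Num.sqrt (\sum_i v i ^+ 2); set H := \sum_i `|u i - v i|.
have V0 : 0 <= V by exact: sqrtr_ge0.
have H0 : 0 <= H by exact: sumr_ge0.
have vV i : `|v i| <= V.
  rewrite -sqrtr_sqr ler_wsqrtr// (bigD1 i)//= lerDl.
  by apply: sumr_ge0 => j _; exact: sqr_ge0.
rewrite -[leRHS]ger0_norm ?addr_ge0// -sqrtr_sqr ler_wsqrtr// sqrrD.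
rewrite sqr_sqrtr; last by apply: sumr_ge0 => j _; exact: sqr_ge0.
have := @sum_sqr_le_sqr_sum R I (fun i => u i - v i); rewrite -/H.
have : \sum_i v i * (u i - v i) <= V * H.
  rewrite mulr_sumr; apply: ler_sum => i _; apply: le_trans (ler_norm _) _.
  by rewrite normrM ler_wpM2r.
have -> : \sum_i u i ^+ 2 = \sum_i v i ^+ 2 + (\sum_i v i * (u i - v i)) *+ 2
    + \sum_i (u i - v i) ^+ 2.
  rewrite -sumrMnl -!big_split /=; apply: eq_bigr => i _.
  by rewrite -mulr_natl; ring.
rewrite !mulr2n; lra.
Qed.

Section sample_space.
Variables (R : realType) (d k : nat).
Implicit Types s z : sample R d k.

(** The l1 counterpart of [sdist]; being additive over coordinates, it is easy to prove measurable
    and to follow through the RIM recursion. *)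
Definition sdist1 (s s' : sample R d k) : R :=
  \sum_(j < d.+1) `|s.1 ord0 j - s'.1 ord0 j|
  + `|(nat_of_ord s.2)%:R - (nat_of_ord s'.2)%:R|.

Lemma sdist1_ge0 s s' : 0 <= sdist1 s s'.
Proof. by rewrite addr_ge0 // sumr_ge0. Qed.

Lemma sdist1C s s' : sdist1 s s' = sdist1 s' s.
Proof.
by rewrite /sdist1 distrC; congr (_ + _); apply: eq_bigr => j _; rewrite distrC.
Qed.

Lemma coord_le_sdist1 s s' j : `|s.1 ord0 j - s'.1 ord0 j| <= sdist1 s s'.
Proof. by rewrite /sdist1 (bigD1 j)//= -addrA lerDl addr_ge0// sumr_ge0. Qed.

Lemma sdist_le_sdist1 s s' : sdist s s' <= sdist1 s s'.
Proof.
have h0 : 0 <= \sum_(j < d.+1) `|s.1 ord0 j - s'.1 ord0 j| by exact: sumr_ge0.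
rewrite /sdist -[leRHS]ger0_norm ?sdist1_ge0// -sqrtr_sqr ler_wsqrtr// [leRHS]sqrrD.
have := @sum_sqr_le_sqr_sum R _ (fun j => s.1 ord0 j - s'.1 ord0 j).
rewrite (real_normK (num_real ((nat_of_ord s.2)%:R - (nat_of_ord s'.2)%:R))).
set a := (\sum_(j < d.+1) `|_|) in h0 *.
have : 0 <= a * `|(nat_of_ord s.2)%:R - (nat_of_ord s'.2)%:R| by rewrite mulr_ge0.
rewrite mulr2n; lra.
Qed.

Lemma measurable_coord j : measurable_fun setT (fun s : sampleT R d k => s.1 ord0 j).
Proof.
move=> _ B mB; rewrite setTI; apply: sub_sigma_algebra.
by left; exists j, B.
Qed.

Lemma measurable_label : measurable_fun setT (fun s : sampleT R d k => (nat_of_ord s.2)%:R : R).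
Proof.
have mcell (y : 'I_k.+1) : measurable ((fun s : sampleT R d k => s.2) @^-1` [set y]).
  by apply: sub_sigma_algebra; right; exists y.
(* A Dirac mass serves as the probability that [Rintegral_fin_comp] asks for; measurability of the
   label is its first component. *)
pose P0 := @dirac _ (sampleT R d k) (0, ord0) R.
have [] := Rintegral_fin_comp P0 (fun y => (nat_of_ord y)%:R : R) mcell.
by [].
Qed.

Lemma measurable_sdist1 z : measurable_fun setT (fun s : sampleT R d k => sdist1 s z).
Proof.
apply: measurable_funD.
  apply: measurable_sum => j; apply: measurableT_comp => //.
  by apply: measurable_funB => //; exact: measurable_coord.
apply: measurableT_comp => //.
by apply: measurable_funB => //; exact: measurable_label.
Qed.

Lemma measurable_to_sample (dO : measure_display) (O : measurableType dO)
    (h : O -> sampleT R d k) (y : 'I_k.+1) :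
  (forall j, measurable_fun setT (fun w => (h w).1 ord0 j)) ->
  (forall w, (h w).2 = y) -> measurable_fun setT h.
Proof.
move=> mh hy; apply: (@measurability _ _ _ _ setT h (@sample_gen R d k)) => //.
move=> _ [_ [[j [B [mB ->]]]|[y' ->]] <-].
  by have := mh j measurableT B mB.
have [yy'|yy'] := eqVneq y y'.
  rewrite (_ : _ @^-1` _ = setT) ?setTI//; apply/seteqP; split => w //= _.
  by rewrite hy.
rewrite (_ : _ @^-1` _ = set0) ?setI0//; apply/seteqP; split => w //=.
by rewrite hy => /eqP; rewrite (negPf yy').
Qed.

Lemma sample_dense : exists z : nat -> sample R d k,
  forall s (e : R), 0 < e -> exists i, sdist1 s (z i) < e.
Proof.
pose D := ({ffun 'I_d.+1 -> rat} * 'I_k.+1)%type.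
pose zz (q : D) : sample R d k := (\row_j ratr (q.1 j), q.2).
exists (fun i => if unpickle i is Some q then zz q else (0, ord0)).
move=> s e e0.
have e' : 0 < e / d.+1%:R by rewrite divr_gt0.
have [q hq] : {q : 'I_d.+1 -> rat &
    forall j, `|s.1 ord0 j - ratr (q j)| < e / d.+1%:R}.
  apply: (@choice _ _ (fun j q => `|s.1 ord0 j - ratr q| < e / d.+1%:R)) => j.
  have /rat_in_itvoo[q] : s.1 ord0 j < s.1 ord0 j + e / d.+1%:R by rewrite ltrDl.
  rewrite in_itv /= => /andP[h1 h2]; exists q.
  by rewrite distrC gtr0_norm ?subr_gt0// ltrBlDl.
exists (pickle (([ffun j => q j], s.2) : D)); rewrite pickleK /zz /sdist1 /=.
rewrite subrr normr0 addr0.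
have -> : e = \sum_(j < d.+1) e / d.+1%:R.
  by rewrite sumr_const card_ord -[_ *+ _]mulr_natl mulrC divfK// lt0r_neq0.
apply: ltr_sum => [|j _]; first by apply/hasP; exists ord0 => //; rewrite mem_index_enum.
by rewrite !mxE ffunE; exact: hq.
Qed.

(** Each strict sublevel set of [g] is the countable union, over the dense points [z i], of the
    sublevel sets of the cones that lie above [g] with apex at [z i]. *)
Lemma lipschitz_measurable (g : sample R d k -> R) (C : R) :
  (forall s s', `|g s - g s'| <= C * sdist1 s s') ->
  measurable_fun setT (g : sampleT R d k -> R).
Proof.
move=> gC; have [z zd] := sample_dense.
have CM : 0 < `|C| + 1 by rewrite ltr_wpDl.
have gC' s s' : `|g s - g s'| <= (`|C| + 1) * sdist1 s s'.
  apply: le_trans (gC s s') _; rewrite ler_wpM2r ?sdist1_ge0//.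
  by apply: le_trans (ler_norm C) _; rewrite lerDl.
move=> mD; apply: (measurability _ (RGenInftyO.measurableE R)) => //.
move=> _ [_ [a ->] <-]; rewrite setTI.
have -> : g @^-1` `]-oo, a[%classic =
   \bigcup_i [set s : sampleT R d k | g (z i) + (`|C| + 1) * sdist1 s (z i) < a].
  apply/seteqP; split => [s|s [i _]] /=; rewrite in_itv /=; last first.
    apply: le_lt_trans; have := gC' s (z i); rewrite ler_norml; lra.
  (* Within this distance, the increase of [g] from [s] to [z i] and the cone term each cost less
     than half of [a - g s]. *)
  move=> gsa; have [|i zi] := zd s ((a - g s) / (2 * (`|C| + 1))).
    by rewrite divr_gt0 ?mulr_gt0 ?subr_gt0.
  exists i => //; move: zi; rewrite ltr_pdivlMr ?mulr_gt0//.
  rewrite (_ : _ * (2 * _) = 2 * ((`|C| + 1) * sdist1 s (z i))); last by ring.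
  by have := gC' s (z i); rewrite ler_norml /=; lra.
apply: bigcup_measurable => i _.
have mf : measurable_fun setT
    (fun s : sampleT R d k => g (z i) + (`|C| + 1) * sdist1 s (z i)).
  apply: measurable_funD => //; apply: measurable_funM => //.
  exact: measurable_sdist1.
have := mf measurableT _ (measurable_itv `]-oo, a[); rewrite setTI.
by congr measurable; apply/seteqP; split => s /=; rewrite in_itv.
Qed.

(** Balls of radius [eta] around the dense points cover the space, so by continuity from above the
    complement of the first [n] balls has mass at most [eta] for some [n]. A point is sent to one of
    these balls that contains it, or else to [None]. *)
Lemma sample_quantizer (P : probability (sampleT R d k) R) (eta : R) : 0 < eta ->
  exists (K : finType) (cell : sampleT R d k -> K) (rep : K -> sampleT R d k) (trash : K),
    [/\ forall c, measurable (cell @^-1` [set c]),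
        forall s, cell s != trash -> sdist1 s (rep (cell s)) <= eta &
        (P (cell @^-1` [set trash]) <= eta%:E)%E].
Proof.
move=> eta0; have [z zd] := sample_dense.
pose B i := [set s : sampleT R d k | sdist1 s (z i) < eta].
have mB i : measurable (B i).
  have mf := measurable_sdist1 (z i).
  have := mf measurableT _ (measurable_itv `]-oo, eta[); rewrite setTI.
  by congr measurable; apply/seteqP; split => s /=; rewrite in_itv.
pose U n := \bigcap_(i in [set i | (i < n)%N]) ~` B i.
have mU n : measurable (U n) by apply: bigcap_measurableType => i _; exact: measurableC.
have U0 : \bigcap_n U n = set0.
  apply/seteqP; split => s //= sU.
  have [i si] := zd s eta eta0.
  by have := sU i.+1 Logic.I i (ltnSn i); apply.
have cvgU : (P \o U) @ \oo --> (0 : \bar R)%E.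
  rewrite -(measure0 P) -U0; apply: nonincreasing_cvg_mu => //.
  - by rewrite (le_lt_trans (probability_le1 _ _))// ltry.
  - exact: bigcap_measurableType.
  - move=> n m nm; apply/subsetPset => s sU i /= im.
    by apply: sU; exact: leq_trans im nm.
have [n hn] : exists n, (P (U n) <= eta%:E)%E.
  have [n _ hn] := @cvgr_lt _ _ _ _ _ _ (fine_cvg cvgU) _ eta0.
  exists n; have := hn n (leqnn n) => /ltW; rewrite -lee_fin /= fineK//.
  exact: fin_num_measure.
(* [cell] factors through the membership vector [b s], so its fibres are finite unions of measurable
   fibres of [b]. *)
pose b (s : sampleT R d k) := [ffun i : 'I_n => sdist1 s (z i) < eta].
pose cell (s : sampleT R d k) : option 'I_n := [pick i | b s i].
have mb (v : {ffun 'I_n -> bool}) : measurable (b @^-1` [set v]).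
  have -> : b @^-1` [set v] =
      \bigcap_(i in [set: 'I_n]) (if v i then B i else ~` B i).
    apply/seteqP; split => [s <- i _|s sv]; first by rewrite ffunE; case: ifPn => // /negP.
    apply/ffunP => i; have := sv i Logic.I; rewrite ffunE; case: (v i) => //=.
    by move=> /negP/negbTE.
  apply: fin_bigcap_measurable; first exact: finite_finset.
  by move=> i _; case: (v i) => //; exact: measurableC.
have mcell (c : option 'I_n) : measurable (cell @^-1` [set c]).
  have [] := @measure_preimage_fin _ _ _ P _ b
    [pred v : {ffun 'I_n -> bool} | [pick i | v i] == c] mb.
  move=> + _; congr measurable.
  by apply/seteqP; split => s /=; [move=> /eqP | move=> <-; rewrite inE].
exists (option 'I_n), cell, (fun c : option 'I_n => if c is Some i then z i else point), None.
split => //.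
  move=> s; rewrite /cell; case: pickP => // i; rewrite ffunE => si _.
  exact: ltW.
apply: le_trans hn; apply: le_measure; rewrite ?inE//.
move=> s /=; rewrite /cell; case: pickP => // sn _ i /= il.
by have := sn (Ordinal il); rewrite ffunE /= /B /= => ->.
Qed.

End sample_space.

(** * The RIM augmentation *)

Section rim_recursion.
Variable R : realType.
Implicit Types x lam : nat -> R.

(** Each step of the recursion is a convex combination. *)
Lemma rim_rec_norm_le x lam (m : R) j :
  (forall n, `|x n| <= m) -> (forall n, 0 <= lam n <= 1) -> `|rim_rec x lam j| <= m.
Proof.
move=> xm lam01; elim: j => [|j IH] //=.
have := lam01 j => /andP[l0 l1].
apply: le_trans (ler_normD _ _) _; rewrite !normrM (ger0_norm l0) ger0_norm ?subr_ge0//.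
have : (1 - lam j) * `|x j.+1| <= (1 - lam j) * m by rewrite ler_wpM2l ?subr_ge0.
have : lam j * `|rim_rec x lam j| <= lam j * m by rewrite ler_wpM2l.
lra.
Qed.

(** Linearity in the features reduces Lipschitz estimates to [rim_rec_norm_le]. *)
Lemma rim_recB x x' lam j :
  rim_rec x lam j - rim_rec x' lam j = rim_rec (fun n => x n - x' n) lam j.
Proof. by elim: j => //= j <-; ring. Qed.

Lemma rim_rec_dev x lam (m : R) j :
  (forall n, `|x n| <= m) -> (forall n, 0 <= lam n <= 1) ->
  `|rim_rec x lam j.+1 - x j.+1| <= lam j * (2 * m).
Proof.
move=> xm lam01 /=; have /andP[l0 _] := lam01 j.
have -> : (1 - lam j) * x j.+1 + lam j * rim_rec x lam j - x j.+1 =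
  lam j * (rim_rec x lam j - x j.+1) by ring.
rewrite normrM ger0_norm// ler_wpM2l//.
apply: le_trans (ler_normB _ _) _.
by have := rim_rec_norm_le j xm lam01; have := xm j.+1; lra.
Qed.

End rim_recursion.

Section rim_augmentation.
Variables (R : realType) (d k : nat).
Implicit Types (s : sample R d k) (lam : 'I_d -> R).

(** [feat] and [coef] are the extensions by 0 used in [rim_aug]; the default respects the bound
    [feat_max] and the interval [0,1]. *)
Definition feat s (n : nat) : R := odflt 0 (omap (s.1 ord0) (insub n : option 'I_d.+1)).
Definition coef lam (n : nat) : R := odflt 0 (omap lam (insub n)).

Lemma featE s (j : 'I_d.+1) : feat s j = s.1 ord0 j.
Proof. by rewrite /feat valK. Qed.

Lemma coefE lam (j : 'I_d) : coef lam j = lam j.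
Proof. by rewrite /coef valK. Qed.

Lemma rim_augE s lam j : (rim_aug s lam).1 ord0 j = rim_rec (feat s) (coef lam) j.
Proof. by rewrite mxE. Qed.

Lemma coef01 lam : (forall j, 0 <= lam j <= 1) -> forall n, 0 <= coef lam n <= 1.
Proof. by move=> h n; rewrite /coef; case: insubP => //= *; rewrite lexx ler01. Qed.

Lemma feat_max_ge0 s : 0 <= feat_max s.
Proof. by rewrite /feat_max bigmax_idl le_max lexx. Qed.

Lemma feat_le s n : `|feat s n| <= feat_max s.
Proof.
rewrite /feat; case: insubP => [i _ _|_] /=; last by rewrite normr0 feat_max_ge0.
exact: le_bigmax.
Qed.

Lemma rim_aug_coord_lipschitz s s' lam j : (forall i, 0 <= lam i <= 1) ->
  `|(rim_aug s lam).1 ord0 j - (rim_aug s' lam).1 ord0 j| <= sdist1 s s'.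
Proof.
move=> lam01; rewrite !rim_augE rim_recB; apply: rim_rec_norm_le; last exact: coef01.
move=> n; rewrite /feat; case: insubP => [i _ _|_] /=; first exact: coord_le_sdist1.
by rewrite subrr normr0 sdist1_ge0.
Qed.

(** One [sdist1 s s'] for each of the [d.+1] features and one for the label. *)
Lemma rim_aug_lipschitz s s' lam : (forall i, 0 <= lam i <= 1) ->
  sdist1 (rim_aug s lam) (rim_aug s' lam) <= d.+2%:R * sdist1 s s'.
Proof.
move=> lam01; rewrite -natr1 mulrDl mul1r {1}/sdist1 lerD//.
  rewrite mulr_natl -[in leRHS](card_ord d.+1) -sumr_const.
  by apply: ler_sum => j _; exact: rim_aug_coord_lipschitz.
by rewrite /sdist1 /= lerDr sumr_ge0.
Qed.

Lemma sdist_rim_augE s lam : sdist (rim_aug s lam) s =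
  Num.sqrt (\sum_(j < d.+1) ((rim_aug s lam).1 ord0 j - s.1 ord0 j) ^+ 2).
Proof. by rewrite /sdist subrr expr0n addr0. Qed.

Lemma sdist_rim_aug_lipschitz s s' lam : (forall i, 0 <= lam i <= 1) ->
  `|sdist (rim_aug s lam) s - sdist (rim_aug s' lam) s'| <= d.+2%:R * sdist1 s s'.
Proof.
move=> lam01.
suff half s1 s2 : sdist (rim_aug s1 lam) s1 <=
    sdist (rim_aug s2 lam) s2 + d.+2%:R * sdist1 s1 s2.
  by have := half s s'; have := half s' s; rewrite (sdist1C s' s) ler_norml; lra.
rewrite !sdist_rim_augE; apply: le_trans (sqrt_sum_sqr_le _
  (fun j => (rim_aug s2 lam).1 ord0 j - s2.1 ord0 j)) _.
rewrite lerD2l -natr1 mulrDl mul1r.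
apply: (@le_trans _ _ (\sum_(j < d.+1) (sdist1 s1 s2 + `|s1.1 ord0 j - s2.1 ord0 j|))).
  apply: ler_sum => j _.
  have -> a b a' b' : a - b - (a' - b') = (a - a') - (b - b') :> R by ring.
  apply: le_trans (ler_normB _ _) _; rewrite lerD2r.
  exact: rim_aug_coord_lipschitz.
rewrite big_split /= sumr_const card_ord -[_ *+ _]mulr_natl lerD2l.
by rewrite /sdist1 lerDl.
Qed.

(** The first feature does not move, whence [d] terms; keeping the bound linear in [lam] lets the
    expectation produce the factor [e]. *)
Lemma sdist_rim_aug_le s lam : (forall i, 0 <= lam i <= 1) ->
  sdist (rim_aug s lam) s <= \sum_(i < d) lam i * (2 * feat_max s).
Proof.
move=> lam01; apply: le_trans (sdist_le_sdist1 _ _) _.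
rewrite /sdist1 /= subrr normr0 addr0 big_ord_recl rim_augE /= -(featE s ord0).
rewrite subrr normr0 add0r; apply: ler_sum => i _.
rewrite rim_augE -featE -[in leRHS](coefE lam) /=.
by apply: rim_rec_dev; [exact: feat_le | exact: coef01].
Qed.

Lemma sdist_ge0 s s' : 0 <= sdist s s'.
Proof. exact: sqrtr_ge0. Qed.

Lemma sdist_rim_aug_le_max s lam : (forall i, 0 <= lam i <= 1) ->
  sdist (rim_aug s lam) s <= d%:R * (2 * feat_max s).
Proof.
move=> lam01; apply: le_trans (sdist_rim_aug_le s lam01) _.
have c0 : 0 <= 2 * feat_max s by rewrite mulr_ge0 ?feat_max_ge0.
move: (2 * feat_max s) c0 => c c0.
have -> : d%:R * c = \sum_(i < d) c by rewrite sumr_const card_ord mulr_natl.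
by apply: ler_sum => i _; rewrite ler_piMl//; case/andP: (lam01 i).
Qed.

(** * Expectations over random coefficients *)

Section random_coefficients.
Variables (dL : measure_display) (OL : measurableType dL) (PL : probability OL R).

Lemma measurable_rim_aug (Lam : 'I_d -> OL -> R) s :
  (forall j, measurable_fun setT (Lam j)) ->
  measurable_fun setT (fun w => rim_aug s (Lam^~ w) : sampleT R d k).
Proof.
move=> mLam; apply: (@measurable_to_sample _ _ _ _ _ _ s.2) => // j.
have mcoef n : measurable_fun setT (fun w => coef (Lam^~ w) n).
  by rewrite /coef; case: insubP => [i _ _|_] /=.
rewrite (_ : (fun w => _) = fun w => rim_rec (feat s) (coef (Lam^~ w)) j); last first.
  by apply/funext => w; rewrite rim_augE.
elim: (nat_of_ord j) => [|i IH] /=; first exact: measurable_cst.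
apply: measurable_funD; apply: measurable_funM => //.
by apply: measurable_funB.
Qed.

Lemma measurable_sdist z : measurable_fun setT (fun s : sampleT R d k => sdist s z).
Proof.
rewrite /sdist; apply: measurableT_comp.
  by apply: continuous_measurable_fun; exact: sqrt_continuous.
apply: measurable_funD; last first.
  by apply: measurable_funX; apply: measurable_funB => //; exact: measurable_label.
apply: measurable_sum => j; apply: measurable_funX.
by apply: measurable_funB => //; exact: measurable_coord.
Qed.

Variables (Lam : 'I_d -> OL -> R).
Hypothesis mLam : forall j, measurable_fun setT (Lam j).
Hypothesis Lam01 : forall w j, 0 <= Lam j w <= 1.

Let mdev s : measurable_fun setT (fun w => sdist (rim_aug s (Lam^~ w)) s).
Proof. exact: (measurableT_comp (measurable_sdist s) (measurable_rim_aug s mLam)). Qed.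

Let dev_le s w : `|sdist (rim_aug s (Lam^~ w)) s| <= d%:R * (2 * feat_max s).
Proof. by rewrite ger0_norm ?sdist_ge0// sdist_rim_aug_le_max. Qed.

Lemma aug_dev_ge0 s : 0 <= aug_dev PL Lam s.
Proof. by apply: Rintegral_ge0 => w _; exact: sdist_ge0. Qed.

Lemma aug_devE s :
  (\int[PL]_w (sdist (rim_aug s (fun j => Lam j w)) s)%:E)%E = (aug_dev PL Lam s)%:E.
Proof.
rewrite /aug_dev /Rintegral fineK//.
apply: integrable_fin_num => //.
exact: (integrable_bounded PL (mdev s) (dev_le s)).
Qed.

(** Through [lipschitz_measurable], this makes [aug_dev] a measurable function of the sample. *)
Lemma aug_dev_lipschitz s s' :
  `|aug_dev PL Lam s - aug_dev PL Lam s'| <= d.+2%:R * sdist1 s s'.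
Proof.
rewrite -[leRHS](Rintegral_prob_cst PL).
pose M := Num.max (Num.max (d%:R * (2 * feat_max s)) (d%:R * (2 * feat_max s')))
  (d.+2%:R * sdist1 s s').
apply: (@Rintegral_dist_le _ _ _ _ _ _ _ M) => //; rewrite /M.
- by move=> w; apply: le_trans (dev_le s w) _; rewrite !le_max lexx.
- by move=> w; apply: le_trans (dev_le s' w) _; rewrite !le_max lexx orbT.
- by move=> w; rewrite ger0_norm ?mulr_ge0 ?sdist1_ge0// !le_max lexx orbT.
- by move=> w; exact: sdist_rim_aug_lipschitz.
Qed.

Lemma aug_dev_le s (e : R) : (forall j, Rintegral PL setT (Lam j) = e) ->
  aug_dev PL Lam s <= 2 * feat_max s * d%:R * e.
Proof.
move=> Le.
have iL j : PL.-integrable setT (EFin \o Lam j).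
  apply: (@integrable_bounded _ _ _ _ _ 1) => // w.
  by have /andP[l0 l1] := Lam01 w j; rewrite ger0_norm.
(* Integrability and value are proved together by induction on the index list, since additivity of
   the integral needs the tail to be integrable. *)
have ELam (r : seq 'I_d) (c : R) :
    PL.-integrable setT (EFin \o (fun w => \sum_(i <- r) Lam i w * c)) /\
    Rintegral PL setT (fun w => \sum_(i <- r) Lam i w * c) = \sum_(i <- r) e * c.
  elim: r => [|i r [IH1 IH2]].
    rewrite (_ : (fun w => _) = cst 0); last by apply/funext => w; rewrite big_nil.
    rewrite Rintegral_prob_cst big_nil; split => //.
    by apply: (@integrable_bounded _ _ _ _ _ 0) => // w; rewrite normr0.
  have iLc : PL.-integrable setT (EFin \o (fun w => Lam i w * c)).
    apply: (@integrable_bounded _ _ _ _ _ `|c|) => [|w].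
      by apply: measurable_funM.
    have /andP[l0 l1] := Lam01 w i.
    by rewrite normrM ler_piMl// ger0_norm.
  rewrite (_ : (fun w => _) = (fun w => Lam i w * c + \sum_(i <- r) Lam i w * c)); last first.
    by apply/funext => w; rewrite big_cons.
  split.
    by have := integrableD measurableT iLc IH1; apply: eq_integrable.
  by rewrite RintegralD// IH2 RintegralZr// Le big_cons.
have [iS ES] := ELam (index_enum 'I_d) (2 * feat_max s).
have -> : 2 * feat_max s * d%:R * e = \sum_(i < d) e * (2 * feat_max s).
  by rewrite sumr_const card_ord -[RHS]mulr_natl; ring.
rewrite -ES /aug_dev; apply: le_Rintegral => //.
  exact: (integrable_bounded PL (mdev s) (dev_le s)).
by move=> w _; exact: sdist_rim_aug_le.
Qed.

Variables (Theta : Type) (l : sample R d k -> Theta -> R) (Lip : R).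
Hypothesis l01 : forall s th, 0 <= l s th <= 1.
Hypothesis Lip0 : 0 <= Lip.
Hypothesis lLip : forall th s s', `|l s th - l s' th| <= Lip * sdist s s'.

Lemma loss_lipschitz1 th s s' : `|l s th - l s' th| <= Lip * sdist1 s s'.
Proof. by apply: le_trans (lLip th s s') _; rewrite ler_wpM2l// sdist_le_sdist1. Qed.

Lemma measurable_loss th : measurable_fun setT (fun s : sampleT R d k => l s th).
Proof. exact: lipschitz_measurable (loss_lipschitz1 th). Qed.

Let mloss s th : measurable_fun setT (fun w => l (rim_aug s (Lam^~ w)) th).
Proof. exact: (measurableT_comp (measurable_loss th) (measurable_rim_aug s mLam)). Qed.

Let loss_le1 s th : `|l s th| <= 1.
Proof. by have /andP[l0 l1] := l01 s th; rewrite ger0_norm. Qed.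

Lemma l_aug01 s th : 0 <= l_aug PL Lam l s th <= 1.
Proof.
apply/andP; split; first by apply: Rintegral_ge0 => w _; case/andP: (l01 (rim_aug s (Lam^~ w)) th).
rewrite -[leRHS](Rintegral_prob_cst PL); apply: le_Rintegral => //.
- exact: (@integrable_bounded _ _ _ PL _ 1 (mloss s th)).
- by apply: (@integrable_bounded _ _ _ PL _ 1) => // w; rewrite normr1.
- by move=> w _; case/andP: (l01 (rim_aug s (Lam^~ w)) th).
Qed.

(** The constant does not depend on [th], so this gives both measurability and a quantization
    uniform over [Theta]. *)
Lemma l_aug_lipschitz th s s' :
  `|l_aug PL Lam l s th - l_aug PL Lam l s' th| <= Lip * d.+2%:R * sdist1 s s'.
Proof.
rewrite -[leRHS](Rintegral_prob_cst PL).
pose M := Num.max 1 (Lip * d.+2%:R * sdist1 s s').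
apply: (@Rintegral_dist_le _ _ _ _ _ _ _ M) => //; rewrite /M.
- by move=> w; rewrite le_max loss_le1.
- by move=> w; rewrite le_max loss_le1.
- by move=> w; rewrite ger0_norm ?mulr_ge0 ?sdist1_ge0// le_max lexx orbT.
- move=> w; apply: le_trans (loss_lipschitz1 th _ _) _.
  by rewrite -mulrA ler_wpM2l// rim_aug_lipschitz.
Qed.

Lemma l_aug_close s th : `|l_aug PL Lam l s th - l s th| <= Lip * aug_dev PL Lam s.
Proof.
rewrite -[l s th in leLHS](Rintegral_prob_cst PL) /aug_dev.
rewrite -RintegralZl//; last exact: (integrable_bounded PL (mdev s) (dev_le s)).
pose M := Num.max 1 (Lip * (d%:R * (2 * feat_max s))).
apply: (@Rintegral_dist_le _ _ _ _ _ _ _ M) => //; rewrite /M.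
- exact: measurable_funM.
- by move=> w; rewrite le_max loss_le1.
- by move=> w; rewrite le_max loss_le1.
- by move=> w; rewrite normrM ger0_norm// le_max ler_wpM2l ?orbT.
- by move=> w; exact: lLip.
Qed.

(** [l_aug_close] integrated over the sample; the extended reals accommodate an infinite expected
    deviation. *)
Lemma pop_risk_close (P : probability (sampleT R d k) R) th :
  (`|pop_risk P l th - Rintegral P setT (fun s : sampleT R d k => l_aug PL Lam l s th)|%:E
   <= Lip%:E * pop_aug_dev P PL Lam)%E.
Proof.
have m1 := measurable_loss th.
have m2 : measurable_fun setT (fun s : sampleT R d k => l_aug PL Lam l s th).
  exact: lipschitz_measurable (l_aug_lipschitz th).
have m3 : measurable_fun setT (fun s : sampleT R d k => aug_dev PL Lam s).
  exact: lipschitz_measurable aug_dev_lipschitz.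
have i1 := integrable_bounded P m1 (loss_le1^~ th).
have i2 : P.-integrable setT (EFin \o (fun s : sampleT R d k => l_aug PL Lam l s th)).
  apply: (@integrable_bounded _ _ _ P _ 1) => // s.
  by have /andP[l0 l1] := l_aug01 s th; rewrite ger0_norm.
have m4 := measurable_funB m1 m2.
have i3 : P.-integrable setT (EFin \o (fun s : sampleT R d k => l s th - l_aug PL Lam l s th)).
  apply: (@integrable_bounded _ _ _ P _ 2) => // s.
  by have := l_aug01 s th; have := l01 s th; rewrite ler_norml => ? ?; lra.
rewrite /pop_risk -RintegralB// EFin_normr_Rintegral//.
apply: le_trans (le_abse_integral _ _ _) _ => //; first exact/measurable_EFinP.
rewrite /pop_aug_dev; under [in leRHS]eq_integral do rewrite aug_devE.
rewrite -ge0_integralZl_EFin//; last first.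
- exact/measurable_EFinP.
- by move=> s _; rewrite lee_fin aug_dev_ge0.
apply: ge0_le_integral => //.
- by apply/measurable_EFinP; exact: measurableT_comp.
- by apply/measurable_EFinP; exact: measurable_funM.
- by move=> s _; rewrite lee_fin distrC l_aug_close.
Qed.

End random_coefficients.
End rim_augmentation.

(** * Clipping the coefficients to the unit interval *)

Section clipping.
Variable R : realType.

(* The coefficients lie in [0,1) only almost surely; clipping makes this hold
   everywhere without changing any of the integrals. *)
Definition clip01 (x : R) : R := x * \1_[set x : R | 0 <= x < 1] x.

Lemma clip01_id x : 0 <= x < 1 -> clip01 x = x.
Proof. by move=> x01; rewrite /clip01 indicE mem_set// mulr1. Qed.

Lemma clip01_itv x : 0 <= clip01 x <= 1.
Proof.
rewrite /clip01 indicE; case: (boolP (_ \in _)) => [|_]; last by rewrite mulr0 lexx ler01.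
by rewrite inE /= mulr1 => /andP[-> /ltW ->].
Qed.

Lemma measurable_unit_co : measurable [set x : R | 0 <= x < 1].
Proof.
rewrite (_ : [set x : R | 0 <= x < 1] = `[0, 1[%classic); first exact: measurable_itv.
by apply/seteqP; split => x /=; rewrite in_itv.
Qed.

Lemma measurable_clip01 : measurable_fun setT clip01.
Proof. by apply: measurable_funM => //; apply: measurable_indic; exact: measurable_unit_co. Qed.

Variables (D : probability R R) (HD : D [set x : R | 0 <= x < 1] = 1%E).

Lemma clip01_ae : \forall x \ae D, clip01 x = x.
Proof.
exists (~` [set x : R | 0 <= x < 1]); split.
- by apply: measurableC; exact: measurable_unit_co.
- by rewrite probability_setC ?HD ?subee//; exact: measurable_unit_co.
- by move=> x /= hx x01; apply: hx; exact: clip01_id.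
Qed.

Variables (dL : measure_display) (OL : measurableType dL) (PL : probability OL R).

Lemma clip01_ae_law (X : OL -> R) : has_law PL X D ->
  \forall w \ae PL, clip01 (X w) = X w.
Proof.
move=> [mX lawX]; have mI := measurable_unit_co.
exists (X @^-1` (~` [set x : R | 0 <= x < 1])); split.
- by rewrite -[X in measurable X]setTI; apply: mX => //; exact: measurableC.
- rewrite lawX; last exact: measurableC.
  by rewrite probability_setC ?HD ?subee.
- by move=> w /= hx x01; apply: hx; exact: clip01_id.
Qed.

(** The change of variables is applied to the clipped function, which is bounded and hence
    integrable; clipping is the identity [D]-almost everywhere. *)
Lemma Rintegral_clip01_law (X : OL -> R) : has_law PL X D ->
  Rintegral PL setT (clip01 \o X) = Rintegral D setT (fun x => x).
Proof.
move=> [mX lawX]; rewrite /Rintegral; congr fine.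
transitivity (\int[D]_x (clip01 x)%:E)%E; last first.
  apply: ae_eq_integral => //.
  - by apply/measurable_EFinP; exact: measurable_clip01.
  - by have := clip01_ae; apply: filterS => x /= -> _.
have mc : measurable_fun setT (EFin \o clip01).
  by apply/measurable_EFinP; exact: measurable_clip01.
rewrite -[LHS](@integral_pushforward _ _ _ _ R X mX PL setT (EFin \o clip01))//.
  apply: eq_measure_integral => A mA _; exact: lawX.

apply: (@integrable_bounded _ _ _ PL (clip01 \o X) 1).
  exact: measurableT_comp measurable_clip01 mX.
by move=> w /=; have /andP[c0 c1] := clip01_itv (X w); rewrite ger0_norm.
Qed.

End clipping.

(** * Assembly of the excess risk, complexity and deviation bounds *)

Unset Implicit Arguments.
Set Strict Implicit.

Theorem theorem2
  (R : realType) (d k N : nat)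
  (* the data distribution P on R^{d+1} x {0..k} *)
  (P : probability (sampleT R d k) R)
  (* i.i.d. samples s_0, ..., s_N ~ P on a probability space (Omega, Pr) *)
  (dO : measure_display) (Omega : measurableType dO) (Pr : probability Omega R)
  (Smp : 'I_N.+1 -> Omega -> sampleT R d k)
  (HSlaw : forall i, has_law Pr (Smp i) P)
  (HSind : mutually_independent Pr Smp)
  (* parameter set and loss l in [0,1], L-Lipschitz in the sample *)
  (Theta : Type) (l : sample R d k -> Theta -> R)
  (Hl01 : forall s th, 0 <= l s th <= 1)
  (Lip : R)
  (Hlip : forall th (s s' : sample R d k), `|l s th - l s' th| <= Lip * sdist s s')
  (* D : distribution concentrated on [0,1) *)
  (D : probability R R)
  (HD : D [set x : R | 0 <= x < 1] = 1%E)
  (* lambda = (lambda_1, ..., lambda_d), components i.i.d. ~ D *)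
  (dL : measure_display) (OL : measurableType dL) (PL : probability OL R)
  (Lam : 'I_d -> OL -> R)
  (HLlaw : forall j, has_law PL (Lam j) D)
  (HLind : mutually_independent PL Lam)
  (* theta_* minimizes the population risk *)
  (th_star : Theta)
  (Hstar : forall th, pop_risk P l th_star <= pop_risk P l th)
  (* hat theta_aug minimizes the empirical augmented risk on the samples *)
  (th_hat : Omega -> Theta)
  (Hhat : forall w th,
     emp_risk (l_aug PL Lam l) (fun i => (Smp i w : sample R d k)) (th_hat w)
     <= emp_risk (l_aug PL Lam l) (fun i => (Smp i w : sample R d k)) th) :
  (forall delta : R, 0 < delta < 1 ->
     exists A : set Omega, measurable A /\ ((1 - delta)%:E <= Pr A)%E /\
       forall w, A w ->
         ((pop_risk P l (th_hat w) - pop_risk P l th_star)%:E <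
          (2 * rademacher (l_aug PL Lam l) (fun i => (Smp i w : sample R d k))
           + Num.sqrt (2 * ln (2 / delta) / N.+1%:R))%:E
          + (2 * Lip)%:E * pop_aug_dev P PL Lam)%E)
  /\
  (forall w : Omega,
     rademacher (l_aug PL Lam l) (fun i => (Smp i w : sample R d k))
     <= rademacher l (fun i => (Smp i w : sample R d k))
        + \big[Num.max/0]_(i < N.+1) (Lip * aug_dev PL Lam (Smp i w : sample R d k)))
  /\
  (forall (w : Omega) (i : 'I_N.+1),
     aug_dev PL Lam (Smp i w : sample R d k)
     <= 2 * feat_max (Smp i w : sample R d k) * d%:R * Rintegral D setT (fun x : R => x)).
Proof.
have mLam j := proj1 (HLlaw j).
pose Lam' (j : 'I_d) := @clip01 R \o Lam j.
have mLam' j : measurable_fun setT (Lam' j).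
  by apply: measurableT_comp (mLam j); exact: measurable_clip01.
have Lam'01 w j : 0 <= Lam' j w <= 1 by exact: clip01_itv.
have ELam' j : Rintegral PL setT (Lam' j) = Rintegral D setT (fun x => x).
  exact: Rintegral_clip01_law.
have Lam'_ae : \forall w \ae PL, forall j, Lam' j w = Lam j w.
  by apply: filter_forall => j; exact: clip01_ae_law (HLlaw j).
have int_clip (s : sample R d k) (G : sampleT R d k -> R) : measurable_fun setT G ->
    (\int[PL]_w (G (rim_aug s (fun j => Lam j w)))%:E =
     \int[PL]_w (G (rim_aug s (fun j => Lam' j w)))%:E)%E.
  move=> mG; apply: ae_eq_integral => //.
  - by apply/measurable_EFinP; apply: (measurableT_comp mG); exact: measurable_rim_aug.
  - by apply/measurable_EFinP; apply: (measurableT_comp mG); exact: measurable_rim_aug.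
  - apply: filterS Lam'_ae => w wE _.
    by congr (G (rim_aug s _))%:E; apply/funext => j.
have Lip0 : 0 <= Lip.
  (* The Lipschitz inequality between two samples at positive distance forces [Lip] to be
     nonnegative. *)
  pose s1 : sample R d k := (const_mx 1, ord0).
  have sd : 0 < sdist (0, ord0) s1.
    rewrite sqrtr_gt0 /= subrr expr0n addr0 (bigD1 ord0)//= !mxE.
    rewrite sub0r sqrrN expr1n ltr_pwDl//.
    by apply: sumr_ge0 => j _; exact: sqr_ge0.
  by rewrite -(pmulr_lge0 _ sd); apply: le_trans (Hlip th_star _ _).
have lE : l_aug PL Lam l = l_aug PL Lam' l.
  apply/funext => s; apply/funext => th; congr fine; apply: (int_clip s (l^~ th)).
  exact: (measurable_loss Lip0 Hlip).
have dE : aug_dev PL Lam = aug_dev PL Lam' :> (sample R d k -> R).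
  by apply/funext => s; congr fine; exact: (int_clip s _ (measurable_sdist s)).
have pE : pop_aug_dev P PL Lam = pop_aug_dev P PL Lam'.
  apply: eq_integral => s _; exact: (int_clip s _ (measurable_sdist s)).
rewrite {}lE {}dE {}pE in Hhat *.
have f01 := l_aug01 PL mLam' Hl01 Lip0 Hlip.
have fLip := l_aug_lipschitz PL mLam' Lam'01 Hl01 Lip0 Hlip.
split; [|split] => [delta delta01|w|w i]; last 2 first.
- apply: rademacher_perturb => // i th.
  apply: le_trans (l_aug_close PL mLam' Lam'01 Hl01 Lip0 Hlip _ th) _.
  exact: (le_bigmax _ (fun i => Lip * aug_dev PL Lam' (Smp i w : sample R d k)) i).
- exact: aug_dev_le.
have [||A [mA [PA HA]]] := uniform_deviation HSlaw HSind th_star f01 _ _ delta01.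
- by move=> th; exact: lipschitz_measurable (fLip th).
(* Quantizing at radius [eta / (C + 1)] makes the error on [l_aug] at most [eta]; since
   [C + 1 >= 1], the mass of [trash] is at most [eta] too. *)
- move=> eta eta0; pose C := Lip * d.+2%:R.
  have C0 : 0 <= C by rewrite mulr_ge0.
  have C1 : 0 < C + 1 by rewrite ltr_wpDl.
  have [|K [cell [rep [trash [mc cc tc]]]]] := @sample_quantizer R d k P (eta / (C + 1)).
    by rewrite divr_gt0.
  exists K, cell, rep, trash; split => //.
    move=> s sc th; apply: le_trans (fLip th _ _) _; rewrite -/C.
    apply: (@le_trans _ _ (C * (eta / (C + 1)))); first by rewrite ler_wpM2l// cc.
    by rewrite mulrA ler_pdivrMr// mulrC ler_pM2l// lerDl.
  apply: le_trans tc _; rewrite lee_fin ler_pdivrMr// ler_peMr ?(ltW eta0)//.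
  by rewrite lerDr.
exists A; split => //; split => // w /HA/(_ (th_hat w)).
(* Minimality of [th_hat w] disposes of the empirical terms. Passing between [l] and [l_aug] at
   [th_hat w] and at [th_star] costs one deviation term each, whence the factor 2. *)
have := Hhat w th_star.
have := pop_risk_close PL mLam' Lam'01 Hl01 Lip0 Hlip P (th_hat w).
have := pop_risk_close PL mLam' Lam'01 Hl01 Lip0 Hlip P th_star.
(* The product of [Lip] and the expected deviation is treated as one extended real: [-oo]
   contradicts the bounds just introduced, and [+oo] makes the claim trivial. *)
rewrite EFinM -muleA; move: (Lip%:E * _)%E => [x| |] //.
- rewrite !lee_fin -EFinM -EFinD lte_fin !ler_norml; lra.
- by rewrite mulry gtr0_sg// mul1e addey// ltry.
Qed.
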